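(* Let $(P,\Pi)$ be an $n$-dimensional Poisson manifold with a Poisson connection $D$ whose torsion is vanishing. Let $\{e_1,\dots,e_n\}$ be a local frame field on some local chart $U$ of $P$ and $\{\theta^1,\dots,\theta^n\}$ its dual coframe field. Then the Poisson coboundary operator $\partial_\Pi^a$ can be written on $U$ in the form \[ \partial_\Pi^{a}|_UA=-\sum_{i=1}^{n}e_i\wedge D_{\theta^i}A \] for $A\in\mathfrak{X}^a(P)$.
   Context: $\mathfrak{X}^k(P)=\Gamma^\infty(\wedge^kTP)$ and $\Omega^k(P)=\Gamma^\infty(\wedge^kT^*P)$; the pairing is $\langle\alpha_1\wedge\cdots\wedge\alpha_k,X_1\wedge\cdots\wedge X_k\rangle=\det(\alpha_i(X_j))$. The map $\sharp:\Omega^1(P)\to\mathfrak{X}^1(P)$ is given by $\beta(\sharp\alpha)=\langle\beta\wedge\alpha,\Pi\rangle$. Schouten bracket: for $A\in\mathfrak{X}^a$, $B\in\mathfrak{X}^b$, writing $A(F_1,\dots,F_a)=A(dF_1,\dots,dF_a)$, \[ \begin{aligned}[] [A,B]_{\mathrm S}(F_1,\dots,F_{a+b-1})&=\sum_{\sigma\in\mathfrak{S}_{b,a-1}}\mathrm{sgn}(\sigma)A\bigl(B(F_{\sigma(1)},\dots,F_{\sigma(b)}),F_{\sigma(b+1)},\dots,F_{\sigma(a+b-1)}\bigr)\\&\quad-(-1)^{(a-1)(b-1)}\sum_{\sigma\in\mathfrak{S}_{a,b-1}}\mathrm{sgn}(\sigma)B\bigl(A(F_{\sigma(1)},\dots,F_{\sigma(a)}),F_{\sigma(a+1)},\dots,F_{\sigma(a+b-1)}\bigr),\end{aligned}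 \] where $\mathfrak{S}_{p,q}$ is the set of $(p,q)$-shuffles (empty sum if $p$ or $q$ is negative). The Poisson coboundary operator is $\partial_\Pi^a:\mathfrak{X}^a(P)\to\mathfrak{X}^{a+1}(P)$, $\partial_\Pi^a(A)=-[A,\Pi]_{\mathrm S}$; $\partial_\Pi^a|_U$ is its restriction to $U$. A contravariant derivative $D$ assigns to 1-forms $\eta,\alpha$ a 1-form $D_\eta\alpha$, $\mathbb{R}$-linearly in $\alpha$, $C^\infty(P)$-linearly in $\eta$, with $D_\eta(f\alpha)=fD_\eta\alpha+((\sharp\eta)f)\alpha$. It extends to multivector fields by $\langle\alpha_1\wedge\cdots\wedge\alpha_a,D_\eta A\rangle=(\sharp\eta)\langle\alpha_1\wedge\cdots\wedge\alpha_a,A\rangle-\sum_{i=1}^a\langle\alpha_1\wedge\cdots\wedge D_\eta\alpha_i\wedge\cdots\wedge\alpha_a,A\rangle$ (and $D_\eta f=(\sharp\eta)f$ on functions). $D$ is a Poisson connection if $D\Pi=0$. With $[\alpha,\beta]_\Pi=\mathcal{L}_{\sharp\alpha}\beta-\mathcal{L}_{\sharp\beta}\alpha+d\langle\alpha\wedge\beta,\Pi\rangle$, the torsion is $T_D(\alpha,\beta)=D_\alpha\beta-D_\beta\alpha-[\alpha,\beta]_\Pi$; it is vanishing if $T_D(\alpha,\beta)=0$ for all 1-forms $\alpha,\beta$. *)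

(* Defs.v *)
From HB Require Import structures.
From mathcomp Require Import all_boot all_order all_algebra perm.
From mathcomp Require Import boolp classical_sets functions.
From mathcomp Require Import reals topology normedtype landau derive ring.

Set Implicit Arguments.
Unset Strict Implicit.
Unset Printing Implicit Defensive.

Import Order.TTheory GRing.Theory Num.Theory.
Import numFieldNormedType.Exports.

Local Open Scope classical_set_scope.
Local Open Scope ring_scope.

(* For open [V], membership in C^k only depends on the restriction of [f] to
   [V], see [Ck_ext]. *)
Fixpoint Ck (R : realType) (n k : nat) (V : set 'rV[R]_n) (f : 'rV[R]_n -> R)
    : Prop :=
  match k with
  | 0 => forall x, V x -> {for x, continuous f}
  | k'.+1 => (forall x, V x -> differentiable f x) /\
             forall i : 'I_n, Ck k' V ('D_(delta_mx 0 i) f)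
  end.

Definition Cinfty (R : realType) (n : nat) (V : set 'rV[R]_n)
    (f : 'rV[R]_n -> R) : Prop := forall k, Ck k V f.

Lemma near_eq_differentiable (R : realType) (V W : normedModType R)
    (f g : V -> W) (x : V) :
  (\near x, f x = g x) -> differentiable f x -> differentiable g x.
Proof.
move=> fg df; have fgx : f x = g x := nbhs_singleton fg.
have dc : continuous ('d f x) by exact: diff_continuous.
have dg : g \o shift x = cst (g x) + 'd f x +o_ 0 id.
  apply/eqaddoP => e e0.
  have /eqaddoP/(_ e e0) H := diff_locally df.
  have fg0 : \forall y \near (0 : V), f (y + x) = g (y + x).
    by move: fg; rewrite (near_shift 0) subr0.
  apply: filterS2 fg0 H => y.
  by rewrite !fctE /= => ->; rewrite fgx.
by apply/diff_locallyP; rewrite (diff_unique dc dg).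
Qed.

Section CkTheory.
Variables (R : realType) (n : nat).
Implicit Types (V : set 'rV[R]_n) (f g : 'rV[R]_n -> R).

Lemma Ck_ext k V f g : open V -> (forall x, V x -> f x = g x) ->
  Ck k V f -> Ck k V g.
Proof.
elim: k f g => [|k IH] f g oV fg /=.
  move=> cf x Vx; have fgn : \near x, f x = g x.
    by move: (open_nbhs_nbhs (conj oV Vx)); apply: filterS => y; exact: fg.
  rewrite /prop_for /continuous_at -(fg _ Vx).
  exact: cvg_trans (near_eq_cvg fgn) (cf x Vx).
have fgn x : V x -> \near x, f x = g x.
  move=> Vx; move: (open_nbhs_nbhs (conj oV Vx)).
  by apply: filterS => y; exact: fg.
move=> [df cf]; split=> [x Vx|i].
  exact: near_eq_differentiable (fgn x Vx) (df x Vx).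
by apply: IH (cf i) => // x Vx; apply: near_eq_derive; exact: fgn.
Qed.

Lemma CkS k V f : Ck k.+1 V f -> Ck k V f.
Proof.
elim: k f => [|k IH] f [df cf] /=.
  by move=> x Vx; exact: differentiable_continuous (df x Vx).
by split=> // i; apply: IH; exact: cf.
Qed.

Lemma Ck_cst k V (c : R) : open V -> Ck k V (cst c).
Proof.
move=> oV; elim: k c => [|k IH] c /=; first by move=> x _; exact: cst_continuous.
split=> [x _|i]; first exact: differentiable_cst.
apply: Ck_ext (IH 0) => // x _; by rewrite derive_cst.
Qed.

Lemma CkD k V f g : open V -> Ck k V f -> Ck k V g -> Ck k V (f + g).
Proof.
move=> oV; elim: k f g => [|k IH] f g /=.
  by move=> cf cg x Vx; apply: continuousD; [exact: cf | exact: cg].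
move=> [df cf] [dg cg]; split=> [x Vx|i].
  by apply: differentiableD; [exact: df | exact: dg].
apply: Ck_ext (IH _ _ (cf i) (cg i)) => // x Vx; rewrite deriveD //.
  exact/diff_derivable/df.
exact/diff_derivable/dg.
Qed.

Lemma CkM k V f g : open V -> Ck k V f -> Ck k V g -> Ck k V (f * g).
Proof.
move=> oV; elim: k f g => [|k IH] f g.
  by move=> cf cg x Vx; apply: continuousM; [exact: cf | exact: cg].
move=> Cf Cg; have Cf' := CkS Cf; have Cg' := CkS Cg.
case: Cf Cg => [df cf] [dg cg]; split=> [x Vx|i].
  by apply: differentiableM; [exact: df | exact: dg].
apply: Ck_ext (CkD oV (IH _ _ Cf' (cg i)) (IH _ _ Cg' (cf i))) => // x Vx.
rewrite deriveM //; first exact/diff_derivable/df.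
exact/diff_derivable/dg.
Qed.

End CkTheory.

(* [cmap] and [cinv] are total functions, meaningful only on [cdom] and on
   [cmap @` cdom]. *)
Record chart (R : realType) (n : nat) (T : topologicalType) := Chart {
  cdom : set T;
  cmap : T -> 'rV[R]_n;
  cinv : 'rV[R]_n -> T;
  cdom_open : open cdom;
  cimg_open : open (cmap @` cdom);
  cmapK : forall x, cdom x -> cinv (cmap x) = x;
  cmap_continuous : {within cdom, continuous cmap};
  cinv_continuous : {within cmap @` cdom, continuous cinv}
}.

Definition smooth_transition (R : realType) (n : nat) (T : topologicalType)
    (c1 c2 : chart R n T) : Prop :=
  forall j : 'I_n, Cinfty (cmap c1 @` (cdom c1 `&` cdom c2))
                          (fun x => cmap c2 (cinv c1 x) 0 j).

Definition compatible (R : realType) (n : nat) (T : topologicalType)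
    (c1 c2 : chart R n T) : Prop :=
  smooth_transition c1 c2 /\ smooth_transition c2 c1.

Record manifold (R : realType) (n : nat) := Manifold {
  msort :> topologicalType;
  mhausdorff : hausdorff_space msort;
  msecond_countable : @second_countable msort;
  atlas : set (chart R n msort);
  atlas_cover : forall p : msort, exists2 c, atlas c & cdom c p;
  atlas_compatible : forall c1 c2, atlas c1 -> atlas c2 -> compatible c1 c2;
  atlas_maximal : forall c, (forall c', atlas c' -> compatible c c') -> atlas c
}.

Definition smooth_on (R : realType) (n : nat) (P : manifold R n)
    (U : set P) (f : P -> R) : Prop :=
  forall c : chart R n P, atlas c ->
    Cinfty (cmap c @` (cdom c `&` U)) (f \o cinv c).

Record smoothfun (R : realType) (n : nat) (P : manifold R n) := SmoothFun {
  sfun :> P -> R;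
  sfun_smooth : smooth_on setT sfun
}.

Section SmoothFunctions.
Variables (R : realType) (n : nat) (P : manifold R n).
Local Notation C := (smoothfun P).
Implicit Types f g h : C.

Lemma smoothfunP f g : sfun f =1 sfun g -> f = g.
Proof.
case: f g => [f fs] [g gs] /= /funext fg; case: _ / fg in gs *.
by congr SmoothFun; exact: Prop_irrelevance.
Qed.

Lemma smooth_cst (a : R) : smooth_on [set: P] (cst a).
Proof. by move=> c _ k; apply: Ck_cst; rewrite setIT; exact: cimg_open. Qed.

Lemma smoothD f g : smooth_on setT (fun p => f p + g p).
Proof.
move=> c ac k; apply: CkD; first by rewrite setIT; exact: cimg_open.
  exact: (sfun_smooth f ac).
exact: (sfun_smooth g ac).
Qed.

Lemma smoothM f g : smooth_on setT (fun p => f p * g p).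
Proof.
move=> c ac k; apply: CkM; first by rewrite setIT; exact: cimg_open.
  exact: (sfun_smooth f ac).
exact: (sfun_smooth g ac).
Qed.

Definition scst (a : R) : C := SmoothFun (@smooth_cst a).
Definition sadd f g : C := SmoothFun (smoothD f g).
Definition smul f g : C := SmoothFun (smoothM f g).
Definition sopp f : C := smul (scst (-1)) f.

HB.instance Definition _ := gen_eqMixin C.
HB.instance Definition _ := gen_choiceMixin C.

Lemma saddA : associative sadd.
Proof. by move=> f g h; apply: smoothfunP => p /=; rewrite addrA. Qed.
Lemma saddC : commutative sadd.
Proof. by move=> f g; apply: smoothfunP => p /=; rewrite addrC. Qed.
Lemma sadd0 : left_id (scst 0) sadd.
Proof. by move=> f; apply: smoothfunP => p /=; rewrite add0r. Qed.
Lemma saddN : left_inverse (scst 0) sopp sadd.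
Proof. by move=> f; apply: smoothfunP => p /=; rewrite mulN1r addNr. Qed.
HB.instance Definition _ := GRing.isZmodule.Build C saddA saddC sadd0 saddN.

Lemma smulA : associative smul.
Proof. by move=> f g h; apply: smoothfunP => p /=; rewrite mulrA. Qed.
Lemma smulC : commutative smul.
Proof. by move=> f g; apply: smoothfunP => p /=; rewrite mulrC. Qed.
Lemma smul1 : left_id (scst 1) smul.
Proof. by move=> f; apply: smoothfunP => p /=; rewrite mul1r. Qed.
Lemma smulDl : left_distributive smul +%R.
Proof. by move=> f g h; apply: smoothfunP => p /=; rewrite mulrDl. Qed.
HB.instance Definition _ :=
  GRing.Zmodule_isComPzRing.Build C smulA smulC smul1 smulDl.

Definition sscale (a : R) f : C := scst a * f.
Lemma sscaleA a b f : sscale a (sscale b f) = sscale (a * b) f.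
Proof. by apply: smoothfunP => p /=; rewrite mulrA. Qed.
Lemma sscale1 : left_id 1 sscale.
Proof. by move=> f; apply: smoothfunP => p /=; rewrite mul1r. Qed.
Lemma sscaleDr : right_distributive sscale +%R.
Proof. by move=> a f g; apply: smoothfunP => p /=; rewrite mulrDr. Qed.
Lemma sscaleDl f : {morph sscale^~ f : a b / a + b}.
Proof. by move=> a b; apply: smoothfunP => p /=; rewrite mulrDl. Qed.
HB.instance Definition _ :=
  GRing.Zmodule_isLmodule.Build R C sscaleA sscale1 sscaleDr sscaleDl.

Lemma sfunD f g p : (f + g) p = f p + g p.
Proof. by []. Qed.
Lemma sfunM f g p : (f * g) p = f p * g p.
Proof. by []. Qed.
Lemma sfunZ (a : R) f p : (a *: f) p = a * f p.
Proof. by []. Qed.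
Lemma sfunN f p : (- f) p = - f p.
Proof. by rewrite /= mulN1r. Qed.
Lemma sfun0 p : (0 : C) p = 0.
Proof. by []. Qed.
Lemma sfun1 p : (1 : C) p = 1.
Proof. by []. Qed.

End SmoothFunctions.

(* T_p P as the space of derivations at p of the algebra of smooth functions. *)
Record tangent (R : realType) (n : nat) (P : manifold R n) (p : P) := Tangent {
  tfun :> smoothfun P -> R;
  tfun_linear : forall (a : R) f g, tfun (a *: f + g) = a * tfun f + tfun g;
  tfun_leibniz : forall f g, tfun (f * g) = f p * tfun g + g p * tfun f
}.

Section TangentSpace.
Variables (R : realType) (n : nat) (P : manifold R n) (p : P).
Local Notation T := (tangent p).
Implicit Types u v w : T.

Lemma tangentP u v : tfun u =1 tfun v -> u = v.
Proof.
case: u v => [u u1 u2] [v v1 v2] /= /funext uv; case: _ / uv in v1 v2 *.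
by congr Tangent; exact: Prop_irrelevance.
Qed.

Fact tzero_linear (a : R) (f g : smoothfun P) : 0 = a * 0 + 0 :> R.
Proof. by rewrite mulr0 addr0. Qed.
Fact tzero_leibniz (f g : smoothfun P) : 0 = f p * 0 + g p * 0 :> R.
Proof. by rewrite !mulr0 addr0. Qed.
Definition tzero : T := Tangent tzero_linear tzero_leibniz.

Fact tlin_linear (b : R) u v (a : R) (f g : smoothfun P) :
  b * u (a *: f + g) + v (a *: f + g) = a * (b * u f + v f) + (b * u g + v g).
Proof. by rewrite !tfun_linear !mulrDr mulrCA -!addrA; congr (_ + _); rewrite addrCA. Qed.
Fact tlin_leibniz (b : R) u v (f g : smoothfun P) :
  b * u (f * g) + v (f * g) = f p * (b * u g + v g) + g p * (b * u f + v f).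
Proof.
rewrite !tfun_leibniz !mulrDr !(mulrCA b) -!addrA; congr (_ + _).
by rewrite addrCA.
Qed.
Definition tlin (b : R) u v : T :=
  Tangent (tlin_linear b u v) (tlin_leibniz b u v).

Definition tadd := tlin 1.
Definition tscale a u := tlin a u tzero.
Definition topp := tscale (-1).

HB.instance Definition _ := gen_eqMixin T.
HB.instance Definition _ := gen_choiceMixin T.

Lemma taddA : associative tadd.
Proof. by move=> u v w; apply: tangentP => f /=; rewrite !mul1r addrA. Qed.
Lemma taddC : commutative tadd.
Proof. by move=> u v; apply: tangentP => f /=; rewrite !mul1r addrC. Qed.
Lemma tadd0 : left_id tzero tadd.
Proof. by move=> u; apply: tangentP => f /=; rewrite mulr0 add0r. Qed.
Lemma taddN : left_inverse tzero topp tadd.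
Proof.
by move=> u; apply: tangentP => f /=; rewrite addr0 mul1r mulN1r addNr.
Qed.
HB.instance Definition _ := GRing.isZmodule.Build T taddA taddC tadd0 taddN.

Lemma tscaleA a b u : tscale a (tscale b u) = tscale (a * b) u.
Proof. by apply: tangentP => f /=; rewrite !addr0 mulrA. Qed.
Lemma tscale1 : left_id 1 tscale.
Proof. by move=> u; apply: tangentP => f /=; rewrite addr0 mul1r. Qed.
Lemma tscaleDr : right_distributive tscale +%R.
Proof.
by move=> a u v; apply: tangentP => f /=; rewrite !addr0 !mul1r mulrDr.
Qed.
Lemma tscaleDl u : {morph tscale^~ u : a b / a + b}.
Proof.
by move=> a b; apply: tangentP => f /=; rewrite !addr0 mul1r mulrDl.
Qed.
HB.instance Definition _ :=
  GRing.Zmodule_isLmodule.Build R T tscaleA tscale1 tscaleDr tscaleDl.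

Lemma tfunD u v f : (u + v) f = u f + v f.
Proof. by rewrite /= mul1r. Qed.
Lemma tfunZ (a : R) u f : (a *: u) f = a * u f.
Proof. by rewrite /= addr0. Qed.
Lemma tfun0 f : (0 : T) f = 0.
Proof. by []. Qed.

End TangentSpace.

Record cotangent (R : realType) (n : nat) (P : manifold R n) (p : P) :=
  Cotangent {
  cfun :> tangent p -> R;
  cfun_linear : forall (a : R) u v, cfun (a *: u + v) = a * cfun u + cfun v
}.

Section CotangentSpace.
Variables (R : realType) (n : nat) (P : manifold R n) (p : P).
Local Notation T := (cotangent p).
Implicit Types x y z : T.

Lemma cotangentP x y : cfun x =1 cfun y -> x = y.
Proof.
case: x y => [x x1] [y y1] /= /funext xy; case: _ / xy in y1 *.
by congr Cotangent; exact: Prop_irrelevance.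
Qed.

Fact czero_linear (a : R) (u v : tangent p) : 0 = a * 0 + 0 :> R.
Proof. by rewrite mulr0 addr0. Qed.
Definition czero : T := Cotangent czero_linear.

Fact clin_linear (b : R) x y (a : R) (u v : tangent p) :
  b * x (a *: u + v) + y (a *: u + v) = a * (b * x u + y u) + (b * x v + y v).
Proof.
rewrite !cfun_linear !mulrDr mulrCA -!addrA; congr (_ + _).
by rewrite addrCA.
Qed.
Definition clin (b : R) x y : T := Cotangent (clin_linear b x y).

Definition cadd := clin 1.
Definition cscale a x := clin a x czero.
Definition copp := cscale (-1).

HB.instance Definition _ := gen_eqMixin T.
HB.instance Definition _ := gen_choiceMixin T.

Lemma caddA : associative cadd.
Proof. by move=> x y z; apply: cotangentP => u /=; rewrite !mul1r addrA. Qed.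
Lemma caddC : commutative cadd.
Proof. by move=> x y; apply: cotangentP => u /=; rewrite !mul1r addrC. Qed.
Lemma cadd0 : left_id czero cadd.
Proof. by move=> x; apply: cotangentP => u /=; rewrite mulr0 add0r. Qed.
Lemma caddN : left_inverse czero copp cadd.
Proof.
by move=> x; apply: cotangentP => u /=; rewrite addr0 mul1r mulN1r addNr.
Qed.
HB.instance Definition _ := GRing.isZmodule.Build T caddA caddC cadd0 caddN.

Lemma cscaleA a b x : cscale a (cscale b x) = cscale (a * b) x.
Proof. by apply: cotangentP => u /=; rewrite !addr0 mulrA. Qed.
Lemma cscale1 : left_id 1 cscale.
Proof. by move=> x; apply: cotangentP => u /=; rewrite addr0 mul1r. Qed.
Lemma cscaleDr : right_distributive cscale +%R.
Proof.
by move=> a x y; apply: cotangentP => u /=; rewrite !addr0 !mul1r mulrDr.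
Qed.
Lemma cscaleDl x : {morph cscale^~ x : a b / a + b}.
Proof.
by move=> a b; apply: cotangentP => u /=; rewrite !addr0 mul1r mulrDl.
Qed.
HB.instance Definition _ :=
  GRing.Zmodule_isLmodule.Build R T cscaleA cscale1 cscaleDr cscaleDl.

Lemma cfunD x y u : (x + y) u = x u + y u.
Proof. by rewrite /= mul1r. Qed.
Lemma cfunZ (a : R) x u : (a *: x) u = a * x u.
Proof. by rewrite /= addr0. Qed.
Lemma cfun0 u : (0 : T) u = 0.
Proof. by []. Qed.

Fact dat_linear (f : smoothfun P) (a : R) (u v : tangent p) :
  (a *: u + v) f = a * u f + v f.
Proof. by rewrite tfunD tfunZ. Qed.
Definition dat (f : smoothfun P) : T := Cotangent (dat_linear f).

End CotangentSpace.

(* An element of the k-th exterior power of T_p P, seen as an alternating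
   k-linear form on T_p^* P through the pairing
   <w_1 /\ ... /\ w_k, X_1 /\ ... /\ X_k> = det (w_i (X_j)). *)
Record multivector (R : realType) (n : nat) (P : manifold R n) (p : P)
    (k : nat) := Multivector {
  mvfun :> ('I_k -> cotangent p) -> R;
  mv_linear : forall (w : 'I_k -> cotangent p) (i : 'I_k) (a : R) x y,
    mvfun [eta w with i |-> a *: x + y] =
    a * mvfun [eta w with i |-> x] + mvfun [eta w with i |-> y];
  mv_alternating : forall (w : 'I_k -> cotangent p) (i j : 'I_k),
    i != j -> w i = w j -> mvfun w = 0
}.

Fact mvzero_linear (R : realType) (n : nat) (P : manifold R n) (p : P) (k : nat)
    (w : 'I_k -> cotangent p) (i : 'I_k) (a : R) (x y : cotangent p) :
  0 = a * 0 + 0 :> R.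
Proof. by rewrite mulr0 addr0. Qed.

Definition mvzero (R : realType) (n : nat) (P : manifold R n) (p : P)
    (k : nat) : multivector p k :=
  @Multivector _ _ _ p k (fun=> 0) (@mvzero_linear _ _ _ p k)
    (fun _ _ _ _ _ => erefl).

HB.instance Definition _ (R : realType) (n : nat) (P : manifold R n) (p : P)
  (k : nat) := gen_eqMixin (multivector p k).
HB.instance Definition _ (R : realType) (n : nat) (P : manifold R n) (p : P)
  (k : nat) := gen_choiceMixin (multivector p k).

(* Smooth sections of TP; smoothness is tested on all smooth functions. *)
Record vfield (R : realType) (n : nat) (P : manifold R n) := VField {
  vfun :> forall p : P, tangent p;
  vfun_smooth : forall f : smoothfun P, smooth_on setT (fun p => vfun p f)
}.

(* Smooth sections of T^*P; smoothness is tested on all smooth vector fields. *)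
Record oneform (R : realType) (n : nat) (P : manifold R n) := OneForm {
  ofun :> forall p : P, cotangent p;
  ofun_smooth : forall X : vfield P, smooth_on setT (fun p => ofun p (X p))
}.

(* Smooth sections of the k-th exterior power of TP; smoothness is tested on
   all families of k smooth 1-forms. *)
Record mvfield (R : realType) (n : nat) (P : manifold R n) (k : nat) :=
  MVField {
  mfun :> forall p : P, multivector p k;
  mfun_smooth : forall w : 'I_k -> oneform P,
    smooth_on setT (fun p => mfun p (fun i => w i p))
}.

Section Fields.
Variables (R : realType) (n : nat) (P : manifold R n).
Local Notation C := (smoothfun P).

Definition vapp (X : vfield P) (f : C) : C := SmoothFun (vfun_smooth X f).

Definition oapp (w : oneform P) (X : vfield P) : C :=
  SmoothFun (ofun_smooth w X).

(* <w_1 /\ ... /\ w_k, A>, see [multivector]. *)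
Definition pairing k (w : 'I_k -> oneform P) (A : mvfield P k) : C :=
  SmoothFun (mfun_smooth A w).

Definition dform (f : C) : oneform P :=
  @OneForm _ _ P (fun p => dat p f) (fun X => vfun_smooth X f).

Definition mapp k (A : mvfield P k) (F : 'I_k -> C) : C :=
  pairing (fun i => dform (F i)) A.

Fact vbracket_linear (X Y : vfield P) p (a : R) (f g : C) :
  X p (vapp Y (a *: f + g)) - Y p (vapp X (a *: f + g)) =
  a * (X p (vapp Y f) - Y p (vapp X f)) + (X p (vapp Y g) - Y p (vapp X g)).
Proof.
have E (Z : vfield P) : vapp Z (a *: f + g) = a *: vapp Z f + vapp Z g.
  by apply: smoothfunP => q; rewrite sfunD sfunZ /= tfun_linear.
by rewrite !E !tfun_linear mulrBr opprD addrACA.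
Qed.

Fact vbracket_leibniz (X Y : vfield P) p (f g : C) :
  X p (vapp Y (f * g)) - Y p (vapp X (f * g)) =
  f p * (X p (vapp Y g) - Y p (vapp X g)) +
  g p * (X p (vapp Y f) - Y p (vapp X f)).
Proof.
have E (Z : vfield P) : vapp Z (f * g) = 1 *: (f * vapp Z g) + g * vapp Z f.
  by apply: smoothfunP => q; rewrite sfunD sfunZ mul1r /= tfun_leibniz.
by rewrite !E !tfun_linear !tfun_leibniz /=; ring.
Qed.

Definition vbracket_at (X Y : vfield P) p : tangent p :=
  Tangent (vbracket_linear X Y p) (vbracket_leibniz X Y p).

Fact vbracket_smooth (X Y : vfield P) (f : C) :
  smooth_on setT (fun p => vbracket_at X Y p f).
Proof. 
have -> : (fun p => vbracket_at X Y p f) = vapp X (vapp Y f) - vapp Y (vapp X f).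
  by apply/funext => p; rewrite sfunD sfunN.
exact: sfun_smooth.
Qed.

Definition vbracket (X Y : vfield P) : vfield P :=
  VField (vbracket_smooth X Y).

Local Notation O := (oneform P).
Implicit Types x y z : O.

Lemma oneformP x y : (forall p, x p = y p) -> x = y.
Proof.
case: x y => [x xs] [y ys] /= xy.
have {}xy : x = y by apply: functional_extensionality_dep.
by case: _ / xy in ys *; congr OneForm; exact: Prop_irrelevance.
Qed.

Fact olin_smooth (f : C) x y (X : vfield P) :
  smooth_on setT (fun p => (f p *: x p + y p) (X p)).
Proof.
have -> : (fun p => (f p *: x p + y p) (X p)) = f * oapp x X + oapp y X.
  by apply/funext => p; rewrite cfunD cfunZ.
exact: sfun_smooth.
Qed.
Definition olin (f : C) x y : O :=
  @OneForm _ _ P (fun p => f p *: x p + y p) (olin_smooth f x y).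

Fact ozero_smooth (X : vfield P) :
  smooth_on setT (fun p => (0 : cotangent p) (X p)).
Proof. exact: (sfun_smooth (0 : C)). Qed.
Definition ozero : O := @OneForm _ _ P (fun=> 0) ozero_smooth.

Definition oadd := olin 1.
Definition oscale f x := olin f x ozero.
Definition oopp := oscale (-1).

HB.instance Definition _ := gen_eqMixin O.
HB.instance Definition _ := gen_choiceMixin O.

Lemma oaddE x y p : oadd x y p = x p + y p.
Proof. by rewrite /= scale1r. Qed.
Lemma oscaleE f x p : oscale f x p = f p *: x p.
Proof. by rewrite /= addr0. Qed.

Lemma oaddA : associative oadd.
Proof. by move=> x y z; apply: oneformP => p; rewrite !oaddE addrA. Qed.
Lemma oaddC : commutative oadd.
Proof. by move=> x y; apply: oneformP => p; rewrite !oaddE addrC. Qed.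
Lemma oadd0 : left_id ozero oadd.
Proof. by move=> x; apply: oneformP => p; rewrite !oaddE add0r. Qed.
Lemma oaddN : left_inverse ozero oopp oadd.
Proof.
move=> x; apply: oneformP => p.
by rewrite oaddE oscaleE sfunN scaleN1r addNr.
Qed.
HB.instance Definition _ := GRing.isZmodule.Build O oaddA oaddC oadd0 oaddN.

Lemma oscaleA f g x : oscale f (oscale g x) = oscale (f * g) x.
Proof. by apply: oneformP => p; rewrite !oscaleE scalerA. Qed.
Lemma oscale1 : left_id 1 oscale.
Proof. by move=> x; apply: oneformP => p; rewrite oscaleE scale1r. Qed.
Lemma oscaleDr : right_distributive oscale +%R.
Proof.
move=> f x y; apply: oneformP => p.
by rewrite (oaddE (oscale f x)) !oscaleE oaddE scalerDr.
Qed.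
Lemma oscaleDl x : {morph oscale^~ x : f g / f + g}.
Proof.
move=> f g; apply: oneformP => p.
by rewrite (oaddE (oscale f x)) !oscaleE scalerDl.
Qed.
HB.instance Definition _ :=
  GRing.Zmodule_isLmodule.Build C O oscaleA oscale1 oscaleDr oscaleDl.

Lemma ofunD x y p : (x + y) p = x p + y p.
Proof. exact: oaddE. Qed.
Lemma ofunZ (f : C) x p : (f *: x) p = f p *: x p.
Proof. exact: oscaleE. Qed.

End Fields.

Definition shuffle (p q : nat) (s : 'S_(p + q)) : bool :=
  [forall i : 'I_p, forall j : 'I_p,
     (i < j)%N ==> (s (lshift q i) < s (lshift q j))%N] &&
  [forall i : 'I_q, forall j : 'I_q,
     (i < j)%N ==> (s (rshift p i) < s (rshift p j))%N].

Section Schouten.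
Variables (R : realType) (n : nat) (P : manifold R n).
Local Notation C := (smoothfun P).

(* The sum over the (b, a-1)-shuffles s of
   sgn(s) A(B(F_s(1), ..., F_s(b)), F_s(b+1), ..., F_s(a+b-1)),
   which is empty for a = 0. *)
Definition insertion (a b : nat) :
    mvfield P a -> mvfield P b -> ('I_(a + b).-1 -> C) -> C :=
  match a return mvfield P a -> mvfield P b -> ('I_(a + b).-1 -> C) -> C with
  | 0 => fun _ _ _ => 0
  | a'.+1 => fun A B F =>
      let F' (i : 'I_(b + a')) := F (cast_ord (addnC b a') i) in
      \sum_(s : 'S_(b + a') | shuffle s)
        (-1) ^+ s *
        mapp A (fun i : 'I_a'.+1 =>
          if unlift ord0 i is Some j then F' (s (rshift b j))
          else mapp B (fun j => F' (s (lshift a' j))))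
  end.

(* The sign exponent (a+1)(b+1) has the parity of (a-1)(b-1) and is meaningful
   for a = 0 or b = 0 too. *)
Definition schouten (a b : nat) (A : mvfield P a) (B : mvfield P b)
    (F : 'I_(a + b).-1 -> C) : C :=
  insertion A B F - (-1) ^+ (a.+1 * b.+1) *
  insertion B A (fun i => F (cast_ord (congr1 predn (addnC b a)) i)).

Definition poisson (Pi : mvfield P 2) : Prop :=
  forall F : 'I_(2 + 2).-1 -> C, schouten Pi Pi F = 0.

Definition coboundary_fun (Pi : mvfield P 2) (a : nat) (A : mvfield P a)
    (F : 'I_a.+1 -> C) : C :=
  - schouten A Pi (fun i => F (cast_ord (congr1 predn (addn2 a)) i)).

(* -[A, Pi]_S is a derivation in each argument, hence depends on the differentials
   of its arguments only: its value at p is the unique multivector at p with the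
   prescribed values on differentials, which span T_p^* P. *)
Definition coboundary (Pi : mvfield P 2) (a : nat) (A : mvfield P a) (p : P) :
    multivector p a.+1 :=
  xget (mvzero p a.+1) [set B : multivector p a.+1 | forall F : 'I_a.+1 -> C,
    B (fun i => dat p (F i)) = coboundary_fun Pi A F p].

End Schouten.

Definition pair2 (T : Type) (x y : T) (i : 'I_2) : T :=
  if i == ord0 then x else y.

Section Contravariant.
Variables (R : realType) (n : nat) (P : manifold R n) (Pi : mvfield P 2).
Local Notation C := (smoothfun P).

(* A tangent vector is determined by its values on the differentials of smooth
   functions, so that beta (sharp alpha) = <beta /\ alpha, Pi> becomes
   (sharp alpha) f = <df /\ alpha, Pi>. *)
Fact sharp_linear (w : oneform P) p (a : R) (f g : C) :
  Pi p (pair2 (dat p (a *: f + g)) (w p)) =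
  a * Pi p (pair2 (dat p f) (w p)) + Pi p (pair2 (dat p g) (w p)).
Proof.
have E x : pair2 x (w p) = [eta pair2 0 (w p) with ord0 |-> x].
  by apply/funext => i; rewrite /pair2 /=; case: ifP.
have -> : dat p (a *: f + g) = a *: dat p f + dat p g.
  by apply: cotangentP => v; rewrite cfunD cfunZ /= tfun_linear.
by rewrite (E (_ + _)) (E (dat p f)) (E (dat p g)) mv_linear.
Qed.

Fact sharp_leibniz (w : oneform P) p (f g : C) :
  Pi p (pair2 (dat p (f * g)) (w p)) =
  f p * Pi p (pair2 (dat p g) (w p)) + g p * Pi p (pair2 (dat p f) (w p)).
Proof.
have E x : pair2 x (w p) = [eta pair2 0 (w p) with ord0 |-> x].
  by apply/funext => i; rewrite /pair2 /=; case: ifP.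
have -> : dat p (f * g) = f p *: dat p g + (g p *: dat p f + 0).
  by apply: cotangentP => v; rewrite addr0 cfunD !cfunZ /= tfun_leibniz.
rewrite (E (_ + _)) (E (dat p f)) (E (dat p g)) mv_linear; congr (_ + _).
rewrite mv_linear.
rewrite [X in _ + X](_ : _ = 0) ?addr0 //.
have := mv_linear (Pi p) (pair2 0 (w p)) ord0 (-1) 0 0.
by rewrite scaler0 addr0 mulN1r addNr.
Qed.

Definition sharp_at (w : oneform P) p : tangent p :=
  Tangent (sharp_linear w p) (sharp_leibniz w p).

Fact sharp_smooth (w : oneform P) (f : C) :
  smooth_on setT (fun p => sharp_at w p f).
Proof.
have -> : (fun p => sharp_at w p f) = pairing (pair2 (dform f) w) Pi.
  apply/funext => p /=; congr (mvfun (Pi p) _).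
  by apply/funext => i; rewrite /pair2; case: ifP.
exact: sfun_smooth.
Qed.

Definition sharp (w : oneform P) : vfield P := VField (sharp_smooth w).

Record contravariant_derivative := ContravariantDerivative {
  cder :> oneform P -> oneform P -> oneform P;
  cder_linearl : forall (f : C) (eta1 eta2 alpha : oneform P),
    cder (f *: eta1 + eta2) alpha = f *: cder eta1 alpha + cder eta2 alpha;
  cder_linearr : forall (r : R) (eta alpha beta : oneform P),
    cder eta (scst P r *: alpha + beta) =
    scst P r *: cder eta alpha + cder eta beta;
  cder_leibniz : forall (f : C) (eta alpha : oneform P),
    cder eta (f *: alpha) = f *: cder eta alpha + vapp (sharp eta) f *: alpha
}.

Definition cder_mv (D : contravariant_derivative) (eta : oneform P)
    (k : nat) (A : mvfield P k) (w : 'I_k -> oneform P) : C :=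
  vapp (sharp eta) (pairing w A) -
  \sum_(i < k) pairing [eta w with i |-> D eta (w i)] A.

Definition poisson_connection (D : contravariant_derivative) : Prop :=
  forall (eta : oneform P) (w : 'I_2 -> oneform P), cder_mv D eta Pi w = 0.

(* The 1-forms L_X w, [alpha, beta]_Pi and T_D(alpha, beta) are given by their
   values on a vector field Y; (L_X w)(Y) = X(w(Y)) - w([X, Y]). *)
Definition lie_derivative (X : vfield P) (w : oneform P) (Y : vfield P) : C :=
  vapp X (oapp w Y) - oapp w (vbracket X Y).

Definition form_bracket (alpha beta : oneform P) (Y : vfield P) : C :=
  lie_derivative (sharp alpha) beta Y - lie_derivative (sharp beta) alpha Y +
  vapp Y (pairing (pair2 alpha beta) Pi).

Definition torsion (D : contravariant_derivative) (alpha beta : oneform P)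
    (Y : vfield P) : C :=
  oapp (D alpha beta) Y - oapp (D beta alpha) Y - form_bracket alpha beta Y.

Definition torsion_free (D : contravariant_derivative) : Prop :=
  forall (alpha beta : oneform P) (Y : vfield P), torsion D alpha beta Y = 0.

(* (D_theta A)(p) for a covector theta at p, as needed for 1-forms defined near p
   only. The right-hand side below depends on eta and on the w i through their
   values at p only, since it is linear in them over the smooth functions; this
   determines a unique multivector at p. *)
Definition cder_at (D : contravariant_derivative) (p : P)
    (theta : cotangent p) (k : nat) (A : mvfield P k) : multivector p k :=
  xget (mvzero p k) [set B : multivector p k |
    forall eta : oneform P, eta p = theta ->
    forall w : 'I_k -> oneform P,
      B (fun i => w i p) = cder_mv D eta A w p].

End Contravariant.

(* The exterior product compatible with the determinant pairing. *)
Definition wedge (R : realType) (n : nat) (P : manifold R n) (p : P) (a b : nat)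
    (A : ('I_a -> cotangent p) -> R) (B : ('I_b -> cotangent p) -> R) :
    ('I_(a + b) -> cotangent p) -> R :=
  fun w => \sum_(s : 'S_(a + b) | shuffle s)
    (-1) ^+ s * A (fun i => w (s (lshift b i))) * B (fun j => w (s (rshift a j))).

Definition vec1 (R : realType) (n : nat) (P : manifold R n) (p : P)
    (v : tangent p) : ('I_1 -> cotangent p) -> R := fun w => w ord0 v.

(* Sections over [U] are total functions, constrained on [U] only. *)
Definition local_frame (R : realType) (n : nat) (P : manifold R n) (U : set P)
    (e : 'I_n -> forall p : P, tangent p) : Prop :=
  (forall i (f : smoothfun P), smooth_on U (fun p => e i p f)) /\
  (forall p, U p -> forall v : tangent p,
     exists! x : 'rV[R]_n, v = \sum_(i < n) x 0 i *: e i p).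

Definition dual_coframe (R : realType) (n : nat) (P : manifold R n) (U : set P)
    (e : 'I_n -> forall p : P, tangent p)
    (theta : 'I_n -> forall p : P, cotangent p) : Prop :=
  forall p, U p -> forall i j, theta i p (e j p) = (i == j)%:R.

(* Main.v *)
Require Import Defs.
From mathcomp Require Import all_boot all_order all_algebra perm.
From mathcomp Require Import boolp classical_sets functions.
From mathcomp Require Import reals topology normedtype landau derive.
From mathcomp Require Import sequences realfun exp zify ring lra.

Set Implicit Arguments.
Unset Strict Implicit.
Unset Printing Implicit Defensive.

Import Order.TTheory GRing.Theory Num.Theory.
Import numFieldNormedType.Exports.

Local Open Scope classical_set_scope.
Local Open Scope ring_scope.

(** Write [F_0, ..., F_a] for smooth functions and [X_f = sharp df]. By
    C^infinity-linearity, the right-hand side evaluated on [dF_0, ..., dF_a] is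
    minus the alternating sum over [j] of [(D_{dF_j} A)(.. omit j ..)].
    Expanding [D A], the terms [X_{F_j} (A (.. omit j ..))] form the half of
    [[A, Pi]] in which [Pi] is outermost. The remaining terms carry
    [D_{dF_j} dF_l] with [j <> l]; they pair up under the exchange of [j] and
    [l] and vanishing torsion turns each pair into
    [D_{df} dg - D_{dg} df = [df, dg]_Pi = d (X_f g)], which gives the other
    half.

    Both [coboundary] and [cder_at] are defined by choice, so one also needs
    that the multivectors they select exist. This rests on two facts at a point of
    the chart: every covector is a differential [dat p f], by counting
    dimensions in the frame; and a 1-form vanishing at [p] is a combination of
    1-forms with coefficients vanishing at [p], by cutting the frame off with a
    smooth bump function. *)

(** * Bump functions in a chart *)

Section FlatFunction.
Variable R : realType.

(* These functions are stable under derivation up to linear combination, so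
   smoothness follows by induction on the order, for all [k] at once. *)
Definition flat (k : nat) (t : R) : R :=
  if 0 < t then t^-1 ^+ k * expR (- t^-1) else 0.

Lemma flat_gt0 k t : 0 < t -> 0 < flat k t.
Proof.
by move=> t0; rewrite /flat t0 mulr_gt0 ?expR_gt0 ?exprn_gt0 ?invr_gt0.
Qed.

Lemma flat_le0 k t : t <= 0 -> flat k t = 0.
Proof. by move=> t0; rewrite /flat ltNge t0. Qed.

(** For t > 0, the exponential series bounds exp(1/t) below by (1/t)^(k+1) / (k+1)!. This is what
    makes the derivatives at 0 vanish. *)
Lemma flat_bound k t : `|flat k t| <= k.+1`!%:R * `|t|.
Proof.
have [t0|t0] := ltP 0 t; last by rewrite flat_le0 // normr0 mulr_ge0.
rewrite !gtr0_norm ?flat_gt0 // /flat t0.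
have s0 : 0 < t^-1 by rewrite invr_gt0.
have h := expR_ge1Dxn k (ltW s0).
rewrite expRN -ler_pdivlMr ?invr_gt0 ?expR_gt0 // invrK.
apply: (@le_trans _ _ (k.+1`!%:R * t * (t^-1 ^+ k.+1 / k.+1`!%:R))).
  have f0 : k.+1`!%:R != 0 :> R by rewrite pnatr_eq0 -lt0n fact_gt0.
  by rewrite exprS; set F := _%:R in f0 *; set s := _ ^+ k; rewrite le_eqVlt;
    apply/orP; left; apply/eqP; field; rewrite f0 gt_eqF.
rewrite ler_pM2l ?mulr_gt0 ?ltr0n ?fact_gt0 //.
by apply: le_trans h; rewrite lerDr.
Qed.

Lemma is_derive_flat k (t : R) :
  is_derive t 1 (flat k) (flat k.+2 t - k%:R * flat k.+1 t).
Proof.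
have [t0|t0|->] := ltgtP t 0.
- rewrite !flat_le0 ?ltW // mulr0 subr0.
  apply: (@near_eq_is_derive _ _ _ (cst 0)).
  by near=> y; rewrite flat_le0 //; apply: ltW; near: y; exact: lt_nbhsl.
- apply: (@near_eq_is_derive _ _ _
    ((fun t => t^-1) ^+ k * (expR \o (fun t => - t^-1)))).
  + by near=> y; rewrite /flat ifT ?fctE ?exprfctE //; near: y; exact: lt_nbhsr.
  + have tn0 : t != 0 by rewrite gt_eqF.
    have dV : is_derive t 1 (fun y : R => y^-1) (- t ^- 2 *: 1).
      exact: is_deriveV.
    have dE := is_derive1_comp (is_derive_expR _) (is_deriveN dV).
    apply: is_derive_eq.
    rewrite /flat t0 /= exprfctE /GRing.scale /=.
    case: k => [|k]; first by rewrite !mul0r subr0 !mulr1 expr0 mul1r mulr0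
      addr0 opprK mulrC exprVn.
    rewrite /= -exprVn !exprS -natr1. ring.
- rewrite !flat_le0 // mulr0 subr0.
  (* At 0 the difference quotient of [flat k] is [flat k.+1], which [flat_bound] squeezes to 0. *)
  have cv : (fun h : R => h^-1 *: ((flat k \o shift 0) (h *: 1) - flat k 0))
      @ 0^' --> (0 : R).
    apply/cvgr0Pnorm_le => e e0; near=> h.
    rewrite /= addr0 [flat k 0]flat_le0 // subr0 /GRing.scale /= mulr1.
    have h0 : h != 0 by near: h; exact: nbhs_dnbhs_neq.
    have -> : h^-1 * flat k h = flat k.+1 h.
      rewrite /flat; case: ifP => _; rewrite ?mulr0 //.
      by rewrite exprS mulrA.
    apply: le_trans (flat_bound _ _) _.
    rewrite -ler_pdivlMl ?ltr0n ?fact_gt0 //.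
    near: h; apply: dnbhs0_le; by rewrite mulr_gt0 // invr_gt0 ltr0n fact_gt0.
  apply: DeriveDef; first by apply/cvg_ex; exists 0.
  exact: cvg_lim cv.
Unshelve. all: by end_near. Qed.

Lemma differentiable_flat k t : differentiable (flat k) t.
Proof. by apply/derivable1_diffP; have [] := is_derive_flat k t. Qed.

End FlatFunction.

(** * Locality of C^k regularity, and compositions with the flat functions *)

Section CkMore.
Variables (R : realType) (n : nat).
Implicit Types (V : set 'rV[R]_n) (f g : 'rV[R]_n -> R).

(** Every clause of [Ck] concerns the total function and its iterated partial derivatives at single
    points of [V]. Together with [Ck_near_ext], this makes smoothness a condition on germs. *)
Lemma Ck_pointwise k V f :
  (forall x, V x -> Ck k [set x] f) <-> Ck k V f.
Proof.
elim: k f => [|k IH] f /=.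
  by split=> [cf x Vx|cf x Vx _ ->]; [exact: (cf x Vx) | exact: cf].
split=> [cf|[df cf]].
  split=> [x Vx|i]; first exact: (cf x Vx).1.
  by apply/IH => x Vx; exact: (cf x Vx).2.
by move=> x Vx; split=> [_ ->|i]; [exact: df | move: x Vx; apply/IH].
Qed.

(** Agreement near [x] is agreement near every point close to [x] ([near_join]), so it passes to the
    partial derivatives. *)
Lemma Ck_near_ext k x f g : (\near x, f x = g x) ->
  Ck k [set x] f -> Ck k [set x] g.
Proof.
elim: k f g => [|k IH] f g fg /=.
  move=> cf _ ->; have := cf _ erefl.
  rewrite /prop_for /continuous_at (nbhs_singleton fg).
  exact: cvg_trans (near_eq_cvg fg).
move=> [df cf]; split=> [_ ->|i].
  exact: near_eq_differentiable fg (df _ erefl).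
apply: IH (cf i); apply: filterS (near_join fg) => y.
exact: near_eq_derive.
Qed.

Lemma Ck_sub k V V' f : V' `<=` V -> Ck k V f -> Ck k V' f.
Proof. by move=> sV /Ck_pointwise cf; apply/Ck_pointwise => x /sV;
  exact: cf. Qed.

Lemma derive_flat_comp k g x v : differentiable g x ->
  'D_v (flat k \o g) x =
  (flat k.+2 (g x) - k%:R * flat k.+1 (g x)) * 'D_v g x.
Proof.
move=> dg; have df : differentiable (flat k) (g x) by exact:
  differentiable_flat.
have := deriveE v (differentiable_comp dg df).
rewrite (diff_comp dg df) /= -(deriveE v dg) => ->; set u := 'D_v g x.
have -> : 'd (flat k) (g x) u = u *: 'd (flat k) (g x) (1 : R).
  by rewrite -linearZ /GRing.scale /= mulr1.
rewrite -(deriveE (1 : R) df) (@derive_val _ _ _ _ _ _ _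
  (is_derive_flat k (g x))).
exact: mulrC.
Qed.

Lemma Ck_flat_comp m k V g : open V -> Cinfty V g ->
  Ck m V (flat k \o g).
Proof.
move=> oV cg; have dg x : V x -> differentiable g x by exact: (cg 1).1.
have dfg l x : V x -> differentiable (flat l \o g) x.
  by move=> Vx; apply: differentiable_comp;
    [exact: dg|exact: differentiable_flat].
elim: m k => [|m IH] k /=.
  by move=> x Vx; exact: differentiable_continuous (dfg _ _ Vx).
split=> [x Vx|i]; first exact: dfg.
have cDg : Ck m V ('D_(delta_mx 0 i) g) by exact: (cg m.+1).2.
have cF := CkD oV (IH k.+2) (CkM oV (Ck_cst m (- k%:R) oV) (IH k.+1)).
apply: Ck_ext (CkM oV cF cDg) => // x Vx.
by rewrite derive_flat_comp; [rewrite !fctE /= mulNr | exact: dg].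
Qed.

Lemma Ck_prod m V (I : Type) (r : seq I) (f : I -> 'rV[R]_n -> R) : open V ->
  (forall i, Ck m V (f i)) -> Ck m V (fun x => \prod_(i <- r) f i x).
Proof.
move=> oV cf; elim: r => [|i r IH].
  by apply: Ck_ext (Ck_cst m 1 oV) => // x _; rewrite big_nil.
by apply: Ck_ext (CkM oV (cf i) IH) => // x _; rewrite big_cons.
Qed.

End CkMore.

(** * Extension by zero and bump functions on the manifold *)

Section Bump.
Variables (R : realType) (n : nat) (P : manifold R n).

Lemma cmap_image (T : topologicalType) (c : chart R n T) (W : set T) :
  cmap c @` (cdom c `&` W) = cmap c @` cdom c `&` cinv c @^-1` W.
Proof.
apply/seteqP; split=> [_ [q [cq Wq] <-]|x [[q cq <-]] /=].
  by split; [exists q | rewrite /= cmapK].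
by rewrite cmapK // => Wq; exists q.
Qed.

Lemma cmap_open (T : topologicalType) (c : chart R n T) (W : set T) :
  open W -> open (cmap c @` (cdom c `&` W)).
Proof.
move=> oW; rewrite cmap_image; have oI := @cimg_open _ _ _ c.
have := @cinv_continuous _ _ _ c.
by rewrite continuous_open_subspace // => /(continuous_inP _ oI); exact.
Qed.

Lemma smooth_onM (U : set P) (f g : P -> R) : open U ->
  smooth_on U f -> smooth_on U g -> smooth_on U (fun q => f q * g q).
Proof.
by move=> oU sf sg c ac k; apply: CkM;
  [exact: cmap_open | exact: sf | exact: sg].
Qed.

Lemma smooth_on_sub (U V : set P) (f : P -> R) : U `<=` V ->
  smooth_on V f -> smooth_on U f.
Proof.
move=> UV sf c ac k; apply: Ck_sub (sf c ac k).
by apply: image_subset; exact: setIS.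
Qed.

Lemma smooth_ext0 (U K : set P) (f g : P -> R) : open U -> closed K ->
  K `<=` U -> smooth_on U f -> (forall q, U q -> g q = f q) ->
  (forall q, ~ K q -> g q = 0) -> smooth_on setT g.
Proof.
move=> oU cK KU sf gf g0 c ac k; rewrite setIT.
have patch W h x : open W -> smooth_on W h -> (forall q, W q -> g q = h q) ->
    (cmap c @` (cdom c `&` W)) x -> Ck k [set x] (g \o cinv c).
  move=> oW sh gh Wx; move/Ck_pointwise: (sh c ac k) => /(_ x Wx).
  apply: Ck_near_ext; have := open_nbhs_nbhs (conj (@cmap_open _ c _ oW) Wx).
  apply: filterS.
  by rewrite cmap_image => y [_ /= /gh].
apply/Ck_pointwise => x [q cq <-]; have [Uq|nUq] := pselect (U q).
  by apply: (patch U f) => //; exists q.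
apply: (patch (~` K) (cst 0)) => //; first exact: closed_openC.
  exact: smooth_on_sub (sfun_smooth (scst P 0)).
by exists q => //; split=> // Kq; exact/nUq/KU.
Qed.

Lemma chart_bump (c : chart R n P) (p : P) : atlas c -> cdom c p ->
  exists (chi : smoothfun P) (K : set P),
    [/\ closed K, K `<=` cdom c, chi p != 0 & forall q, ~ K q -> chi q = 0].
Proof.
(* Balls are open cubes for the norm on row vectors, so the closed cube of half-side [s = r / 2]
   stays inside the image of the chart. *)
move=> ac cp; have : nbhs (cmap c p) (cmap c @` cdom c).
  by apply: open_nbhs_nbhs; split; [exact: cimg_open | exists p].
move=> /nbhs_ballP[r /= r0 rI]; pose s := r / 2.
have s0 : 0 < s by rewrite divr_gt0.
pose I i := `[cmap c p 0 i - s, cmap c p 0 i + s]%classic.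
pose K0 := [set v : 'rV[R]_n | forall i, I i (v 0 i)].
have K0I : K0 `<=` cmap c @` cdom c.
  move=> v Kv; apply: rI; split => // i j; rewrite (ord1 i) /ball /= ltr_norml.
  have := Kv j; rewrite /I /= in_itv /= => /andP[h1 h2].
  by rewrite /s in h1 h2; apply/andP; split; lra.
pose K := cinv c @` K0.
(* [K] is compact as a continuous image of a closed cube; closedness in the whole manifold comes
   from the Hausdorff property. *)
have cK : closed K.
  apply: (compact_closed (@mhausdorff _ _ P)).
  apply: (@continuous_compact _ _ (cinv c) K0); last first.
    by apply: (@rV_compact R n I) => i; exact: segment_compact.
  exact: continuous_subspaceW K0I (@cinv_continuous _ _ _ c).
have KU : K `<=` cdom c by move=> _ [v /K0I [q cq <-] <-]; rewrite cmapK.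
(* Each factor is nonzero exactly when the i-th coordinate is at distance less than [s] from that of
   [p]. *)
pose h i (x : 'rV[R]_n) :=
  flat 0 (s + (x 0 i - cmap c p 0 i)) * flat 0 (s - (x 0 i - cmap c p 0 i)).
pose f q := \prod_(i < n) h i (cmap c q).
pose g q := if `[< cdom c q >] then f q else 0.
have gK q : ~ K q -> g q = 0.
  rewrite /g; case: asboolP => // cq nKq.
  have : ~ K0 (cmap c q).
    by move=> Kq; apply: nKq; exists (cmap c q); rewrite ?cmapK.
  move=> /existsNP[i]; rewrite /I /= in_itv /= => /negP.
  rewrite negb_and -!ltNge => hi.
  rewrite /f (bigD1 i) //= /h; case/orP: hi => hi.
    by rewrite flat_le0 ?mul0r //; lra.
  by rewrite [flat 0 (s - _)]flat_le0 ?mulr0 ?mul0r //; lra.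
(* Read in another chart, [f] is a product of flat functions composed with a smooth transition
   map. *)
have sf : smooth_on (cdom c) f.
  move=> c' ac' k; have oV := @cmap_open _ c' _ (@cdom_open _ _ _ c).
  have tr i : Cinfty (cmap c' @` (cdom c' `&` cdom c))
      (fun x => cmap c (cinv c' x) 0 i).
    exact: (atlas_compatible ac' ac).1.
  apply: Ck_prod => // i; apply: CkM => //.
    apply: (@Ck_flat_comp _ _ _ 0 _
      (fun x => s + (cmap c (cinv c' x) 0 i - cmap c p 0 i))) => // m.
    have := CkD oV (Ck_cst m (s - cmap c p 0 i) oV) (tr i m).
    by apply: Ck_ext => // x _; rewrite !fctE /cst; ring.
  apply: (@Ck_flat_comp _ _ _ 0 _
    (fun x => s - (cmap c (cinv c' x) 0 i - cmap c p 0 i))) => // m.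
  have := CkD oV (Ck_cst m (s + cmap c p 0 i) oV)
    (CkM oV (Ck_cst m (- 1) oV) (tr i m)).
  by apply: Ck_ext => // x _; rewrite !fctE /cst; ring.
have sg : smooth_on setT g.
  apply: smooth_ext0 (@cdom_open _ _ _ c) cK KU sf _ gK => q cq.
  by rewrite /g asboolT.
exists (SmoothFun sg), K; split=> //=.
rewrite /g asboolT // /f prodf_seq_neq0; apply/allP => i _ /=.
by rewrite /h subrr addr0 subr0 mulf_neq0 ?gt_eqF ?flat_gt0.
Qed.

End Bump.

(** * Covectors at a point of the chart *)

Section CovectorsAtPoint.
Variables (R : realType) (n : nat) (P : manifold R n) (p : P).

Lemma cfun_zero (w : cotangent p) : w 0 = 0.
Proof. by have := cfun_linear w (-1) 0 0; rewrite scaler0 addr0 mulN1r addNr.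
  Qed.

Lemma tfun_zero (v : tangent p) : v 0 = 0.
Proof. by have := tfun_linear v (-1) 0 0; rewrite scaler0 addr0 mulN1r addNr.
  Qed.

Lemma cfun_scale (w : cotangent p) a (v : tangent p) : w (a *: v) = a * w v.
Proof. by have := cfun_linear w a v 0; rewrite cfun_zero !addr0. Qed.

Variables (e : 'I_n -> tangent p).
Hypothesis frame : forall v : tangent p,
  exists! x : 'rV[R]_n, v = \sum_(i < n) x 0 i *: e i.

Lemma cfun_sum (w : cotangent p) (I : Type) (r : seq I) (a : I -> R)
    (v : I -> tangent p) :
  w (\sum_(i <- r) a i *: v i) = \sum_(i <- r) a i * w (v i).
Proof.
elim: r => [|i r IH]; first by rewrite !big_nil cfun_zero.
by rewrite !big_cons cfun_linear IH.
Qed.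

Lemma cotangent_frame_eq (w z : cotangent p) :
  (forall i, w (e i) = z (e i)) -> w = z.
Proof.
move=> wz; apply: cotangentP => v; have [x [-> _]] := frame v.
by rewrite !cfun_sum; apply: eq_bigr => i _; rewrite wz.
Qed.

Lemma frame_free (x : 'rV[R]_n) : \sum_(i < n) x 0 i *: e i = 0 -> x = 0.
Proof.
move=> x0; have [y [_ uy]] := frame 0.
rewrite -(uy x (esym x0)); apply: uy.
by rewrite big1 // => i _; rewrite mxE scale0r.
Qed.

(* A vector [y] killed by [k < n] rows is a nonzero tangent vector, hence is not
   killed by the differential of some smooth function: this is a new row. *)
Lemma differentials_rank k : (k <= n)%N ->
  exists F : 'I_k -> smoothfun P, \rank (\matrix_(j < k, i < n) e i (F j)) = k.
Proof.
elim: k => [|k IH] kn; first by exists (fun=> 0); apply/eqP;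
  rewrite -leqn0 rank_leq_row.
have [F rF] := IH (ltnW kn); set M := \matrix_(_, _) _ in rF.
have [y y0 My] : exists2 y : 'rV[R]_n, y != 0 & y *m M^T = 0.
  have : kermx M^T != 0.
    by rewrite -mxrank_eq0 mxrank_ker mxrank_tr rF subn_eq0 -ltnNge.
  by move=> /rowV0Pn[y /sub_kermxP yM yn0]; exists y.
have [f yf] : exists f : smoothfun P, \sum_i y 0 i * e i f != 0.
  apply: contrapT => nf; move/eqP: y0; apply; apply: frame_free.
  apply: tangentP => f; have := cfun_sum (dat p f) (index_enum 'I_n) (y 0) e.
  rewrite /= => ->; apply/eqP/negP => /negP yf; apply: nf; exists f; exact: yf.
exists (fun j : 'I_(1 + k) => if fintype.split j is inr j' then F j' else f).
set M' := (X in \rank X).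
pose r : 'rV[R]_n := \row_i e i f.
have EM : M' = col_mx r M.
  by apply/matrixP => j i; rewrite !mxE; case: fintype.split => j';
    rewrite !mxE.
have -> : \rank M' = \rank (r + M)%MS by rewrite EM; case: (addsmxE r M) => ->.
apply/eqP; rewrite eqn_leq; apply/andP; split.
  apply: leq_trans (mxrank_adds_leqif _ _) _.
  by rewrite rF (leq_add (rank_leq_row r) (leqnn k)).
(* A row spanned by [M] would be killed by [y], whereas [yf] says that [r] is not. *)
have : (M < r + M)%MS.
  rewrite /ltmx addsmxSr addsmx_sub submx_refl andbT;
    apply/negP => /submxP[a ra].
  have yr : y *m r^T = 0 by rewrite ra trmx_mul mulmxA My mul0mx.
  move/eqP: yf; apply; have := congr1 (fun m : 'M_1 => m 0 0) yr.
  by rewrite !mxE => {2}<-; apply: eq_bigr => i _; rewrite !mxE.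
by rewrite ltmxErank rF => /andP[].
Qed.

(** The differentials of [n] functions of rank [n] form a basis; the coordinates of [w] in it give
    the combination of these functions to take. *)
Lemma covector_dat (w : cotangent p) : exists f : smoothfun P, dat p f = w.
Proof.
have [F rF] := differentials_rank (leqnn n); set M := \matrix_(_, _) _ in rF.
pose x : 'rV[R]_n := \row_i w (e i).
have : (x <= M)%MS by apply: submx_full; rewrite -col_leq_rank rF.
case/submxP => a xa; exists (\sum_(j < n) a 0 j *: F j).
apply: cotangent_frame_eq => i /=.
have := congr1 (fun m : 'rV_n => m 0 i) xa; rewrite !mxE => ->.
under [RHS]eq_bigr do rewrite mxE.
have lin (v : tangent p) (s : seq 'I_n) : v (\sum_(j <- s) a 0 j *: F j) =
  \sum_(j <- s) a 0 j * v (F j).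
  by elim: s => [|j s IH]; rewrite ?big_nil ?tfun_zero // !big_cons tfun_linear
    IH.
exact: lin.
Qed.

End CovectorsAtPoint.

(** * Global fields and 1-forms from a local frame *)

Section LocalFrame.
Variables (R : realType) (n : nat) (P : manifold R n).
Variables (c : chart R n P) (e : 'I_n -> forall p : P, tangent p).
Hypotheses (ac : atlas c) (fr : local_frame (cdom c) e).
Implicit Types (p q : P).

Lemma frame_vfields p : cdom c p ->
  exists (chi : smoothfun P) (E : 'I_n -> vfield P),
  [/\ chi p != 0, forall q, ~ cdom c q -> chi q = 0 &
      forall i q, E i q = chi q *: e i q].
Proof.
move=> cp; have [chi [K [cK KU chip chi0]]] := chart_bump ac cp.
have sE i (f : smoothfun P) : smooth_on setT (fun q => (chi q *: e i q) f).
  have oU := @cdom_open _ _ _ c.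
  apply: (@smooth_ext0 _ _ _ (cdom c) K (fun q => chi q * e i q f)) => //.
  - apply: smooth_onM => //; last exact: fr.1.
    exact: smooth_on_sub (sfun_smooth chi).
  - by move=> q _; rewrite tfunZ.
  - by move=> q nKq; rewrite tfunZ chi0 // mul0r.
exists chi, (fun i => VField (sE i)); split=> // q nq.
by apply: chi0 => Kq; exact/nq/KU.
Qed.

Lemma ofun_sum (I : Type) (r : seq I) (g : I -> smoothfun P)
    (z : I -> oneform P) q :
  (\sum_(i <- r) g i *: z i) q = \sum_(i <- r) g i q *: z i q.
Proof.
elim: r => [|i r IH]; first by rewrite !big_nil.
by rewrite !big_cons ofunD ofunZ IH.
Qed.

Lemma sfun_sum (I : Type) (r : seq I) (Q : pred I) (g : I -> smoothfun P) q :
  (\sum_(i <- r | Q i) g i) q = \sum_(i <- r | Q i) g i q.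
Proof.
elim: r => [|i r IH]; first by rewrite !big_nil.
by rewrite !big_cons -IH; case: ifP => _; rewrite ?sfunD.
Qed.

(* Cramer's rule over the ring of smooth functions, for the matrix [N] of the
   derivatives of the [F j] along the cut-off frame; the additional factor [chi]
   makes both sides vanish off the chart. *)
Lemma vanishing_oneform p (eta : oneform P) : cdom c p -> eta p = 0 ->
  exists (u : smoothfun P) (G F : 'I_n -> smoothfun P),
    [/\ u p = 0, forall j, G j p = 0 &
        eta = u *: eta + \sum_(j < n) G j *: dform (F j)].
Proof.
move=> cp eta0; have [chi [E [chip chi0 EE]]] := frame_vfields cp.
have frq q : cdom c q -> forall v : tangent q, exists! x : 'rV[R]_n, v =
  \sum_(i < n) x 0 i *: e i q.
  exact: fr.2.
have [F rF] := differentials_rank (frq p cp) (leqnn n).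
pose N : 'M[smoothfun P]_n := \matrix_(i, j) vapp (E i) (F j).
pose Np : 'M[R]_n := \matrix_(j, i) e i p (F j).
(* Evaluation at [q] is a ring morphism, hence commutes with determinants. *)
have evdet q : sfun (\det N) q = \det (\matrix_(i, j) E i q (F j)).
  rewrite /determinant sfun_sum; apply: eq_bigr => s _.
  rewrite sfunM; congr (_ * _).
    by case: odd_perm; rewrite ?expr0 ?expr1 ?sfunN.
  have ev (r : seq 'I_n) : sfun (\prod_(i <- r) N i (s i)) q =
    \prod_(i <- r) (\matrix_(i, j) E i q (F j)) i (s i).
    by elim: r => [|i r IH]; rewrite ?big_nil // !big_cons sfunM IH !mxE.
  exact: ev.
have detNp : sfun (\det N) p != 0.
  rewrite evdet (_ : (\matrix_(i, j) _) = chi p *: Np^T); last first.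
    by apply/matrixP => i j; rewrite !mxE EE tfunZ.
  rewrite detZ det_tr mulf_neq0 ?expf_neq0 //.
  by rewrite -unitfE -[_ \is a _]/(Np \in unitmx) -row_free_unit /row_free rF.
(* Dividing by [d] normalises [chi * \det N] to 1 at [p], so that the coefficient [u] vanishes
   there. *)
pose d := chi p * sfun (\det N) p.
have d0 : d != 0 by rewrite mulf_neq0.
pose G j := scst P d^-1 * chi * \sum_i Defs.oapp eta (E i) * (\adj N) j i.
exists (1 - scst P d^-1 * chi * \det N), G, F; split.
- by rewrite sfunD sfunN sfun1 2!sfunM /= -mulrA mulVf // subrr.
- move=> j; rewrite /G 2!sfunM sfun_sum big1 ?mulr0 // => i _.
  by rewrite sfunM /= eta0 cfun0 mul0r.
rewrite scalerBl scale1r -[LHS]addr0 -addrA; congr (_ + _).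
apply/esym/eqP; rewrite addrC subr_eq0; apply/eqP; apply: oneformP => q.
rewrite ofun_sum ofunZ 2!sfunM.
have [cq0|cq0] := eqVneq (chi q) 0.
  rewrite cq0 mulr0 mul0r scale0r big1 // => j _.
  by rewrite 2!sfunM cq0 mulr0 mul0r scale0r.
have cq : cdom c q by apply: contrapT => /chi0 /eqP; exact/negP.
apply: (cotangent_frame_eq (frq q cq)) => k; rewrite cfunZ.
have lin (w : cotangent q) : w (e k q) = (chi q)^-1 * w (E k q).
  by rewrite -cfun_scale EE scalerA mulVf // scale1r.
rewrite !lin.
have sumE (r : seq 'I_n) : (\sum_(j <- r) G j q *: dform (F j) q) (E k q) =
  \sum_(j <- r) G j q * N k j q.
  elim: r => [|j r IH]; first by rewrite !big_nil.
  by rewrite !big_cons cfunD cfunZ IH mxE.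
rewrite sumE mulrCA; congr (_ * _).
(* Cramer's rule: in the double sum, [N *m \adj N = (\det N)%:M] leaves only the index [k]. *)
have NN : \sum_j G j * N k j =
    scst P d^-1 * chi * (Defs.oapp eta (E k) * \det N).
  under eq_bigr => j _ do rewrite /G -mulrA mulr_suml.
  rewrite -mulr_sumr exchange_big; congr (_ * _).
  rewrite (bigD1 k) //= [X in _ + X]big1 => [|i ik].
    rewrite addr0; under eq_bigr => j _ do rewrite -mulrA [_ * N _ _]mulrC.
    have := congr1 (fun M : 'M_n => M k k) (mul_mx_adj N).
    by rewrite -mulr_sumr !mxE eqxx mulr1n => ->.
  under eq_bigr => j _ do rewrite -mulrA [_ * N _ _]mulrC.
  have := congr1 (fun M : 'M_n => M k i) (mul_mx_adj N).
  by rewrite -mulr_sumr !mxE eq_sym (negPf ik) mulr0n => ->; rewrite mulr0.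
have := congr1 (fun f : smoothfun P => f q) NN; rewrite sfun_sum /= => ->.
rewrite -!mulrA; congr (_ * _); congr (_ * _); exact: mulrC.
Qed.

End LocalFrame.

(** * Multivectors and their contravariant derivatives *)

Section Update.
Variables (I : eqType) (T : Type).
Implicit Types (w : I -> T) (i j : I) (x y : T).

Lemma upd_same w i x : w i = x -> [eta w with i |-> x] = w :> (I -> T).
Proof. by move=> <-; apply/funext => j /=; case: eqP => [->|]. Qed.

Lemma upd_upd w i x y :
  [eta [eta w with i |-> x] with i |-> y] = [eta w with i |-> y] :> (I -> T).
Proof. by apply/funext => j /=; case: (j == i). Qed.

Lemma upd_comm w i j x y : i != j ->
  [eta [eta w with i |-> x] with j |-> y] =
    [eta [eta w with j |-> y] with i |-> x] :> (I -> T).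
Proof.
move=> ij; apply/funext => l /=.
by case: (eqVneq l j) => [->|//]; rewrite eq_sym (negPf ij).
Qed.

End Update.

Section MultivectorAlgebra.
Variables (R : realType) (n : nat) (P : manifold R n) (p : P) (k : nat).
Variable B : multivector p k.
Implicit Types (w : 'I_k -> cotangent p) (x y : cotangent p) (i j : 'I_k).

Lemma mvD w i x y : B [eta w with i |-> x + y] =
  B [eta w with i |-> x] + B [eta w with i |-> y].
Proof. by have := mv_linear B w i 1 x y; rewrite scale1r mul1r. Qed.

Lemma mv0 w i : B [eta w with i |-> 0] = 0.
Proof.
by apply: (addrI (B [eta w with i |-> 0])); rewrite -mvD !addr0.
Qed.

Lemma mvZ w i a x : B [eta w with i |-> a *: x] = a * B [eta w with i |-> x].
Proof. by have := mv_linear B w i a x 0; rewrite mv0 !addr0. Qed.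

(** Polarisation: expand the value with [x + y] in both slots, which is 0. *)
Lemma mv_swap w i j x y : i != j ->
  B [eta [eta w with i |-> x] with j |-> y] =
    - B [eta [eta w with i |-> y] with j |-> x].
Proof.
move=> ij; apply/eqP; rewrite -addr_eq0; apply/eqP.
have ji : j != i by rewrite eq_sym.
have alt z : B [eta [eta w with i |-> z] with j |-> z] = 0.
  by apply: (@mv_alternating _ _ _ _ _ B _ i j) => //=;
    rewrite !eqxx (negPf ij).
have := alt (x + y); rewrite mvD !(@upd_comm _ _ _ i j) // !mvD.
rewrite -!(@upd_comm _ _ _ i j) //.
by rewrite !alt add0r addr0 addrC.
Qed.

Lemma mv_tperm w i j : i != j -> B (w \o tperm i j) = - B w.
Proof.
move=> ij; have := mv_swap w (w j) (w i) ij.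
rewrite (_ : [eta [eta w with i |-> w i] with j |-> w j] = w :> (_ -> _));
  last first.
  by rewrite !upd_same.
move=> <-; congr (B _); apply/funext => l /=.
case: tpermP => [->|->|]; rewrite ?eqxx ?(negPf ij) //.
by move=> /eqP/negPf -> /eqP/negPf ->.
Qed.

Lemma mv_perm w (s : 'S_k) : B (w \o s) = (-1) ^+ s * B w.
Proof.
have [ts -> /allP dts] := prod_tpermP s; elim: ts dts w => [|t ts IH] dts w.
  rewrite big_nil odd_perm1 mul1r; congr (B _); apply/funext => l /=.
  by rewrite perm1.
have dt : t.1 != t.2 by exact: dts (mem_head _ _).
rewrite big_cons odd_permM odd_tperm dt signr_addb expr1.
have -> : w \o (tperm t.1 t.2 * \prod_(t <- ts) tperm t.1 t.2)%g =
    (w \o (\prod_(t <- ts) tperm t.1 t.2)%g) \o tperm t.1 t.2.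
  by apply/funext => l /=; rewrite permM.
rewrite mv_tperm // IH ?mulN1r ?mulNr //.
by move=> u us; apply: dts; rewrite inE us orbT.
Qed.

End MultivectorAlgebra.

(** * Tensoriality and antisymmetry of the derivative of a multivector field *)

Section ContravariantAlgebra.
Variables (R : realType) (n : nat) (P : manifold R n) (Pi : mvfield P 2).
Variables (D : contravariant_derivative Pi) (k : nat) (A : mvfield P k).
Local Notation C := (smoothfun P).
Implicit Types (f g : C) (eta x y z : oneform P) (w : 'I_k -> oneform P).

Lemma pairing_upd w i x p :
  pairing [eta w with i |-> x] A p = A p [eta (fun j => w j p) with i |-> x p].
Proof. by congr (A p _); apply/funext => j /=; case: ifP. Qed.

Lemma pairing_linear w i f x y :
  pairing [eta w with i |-> f *: x + y] A =
  f * pairing [eta w with i |-> x] A + pairing [eta w with i |-> y] A.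
Proof.
apply: smoothfunP => p; rewrite sfunD sfunM !pairing_upd ofunD ofunZ.
exact: mv_linear.
Qed.

Lemma pairing_alternating w i j : i != j -> w i = w j -> pairing w A = 0.
Proof.
move=> ij wij; apply: smoothfunP => p /=.
by apply: (@mv_alternating _ _ _ _ _ _ _ i j); rewrite ?wij.
Qed.

Lemma vappD (X : vfield P) f g : vapp X (f + g) = vapp X f + vapp X g.
Proof.
apply: smoothfunP => p; have := tfun_linear (X p) 1 f g.
by rewrite scale1r mul1r.
Qed.

Lemma vappM (X : vfield P) f g : vapp X (f * g) = f * vapp X g + g * vapp X f.
Proof. by apply: smoothfunP => p; rewrite sfunD !sfunM;
  exact: tfun_leibniz. Qed.

Lemma vapp0 (X : vfield P) : vapp X 0 = 0.
Proof. by have := vappM X 0 0; rewrite !mul0r addr0. Qed.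

Lemma cderD eta x y : D eta (x + y) = D eta x + D eta y.
Proof.
have := cder_linearr D 1 eta x y; rewrite (_ : scst P 1 = 1) //.
by rewrite !scale1r.
Qed.

Lemma vapp_sharp_linear f eta1 eta2 g :
  vapp (sharp Pi (f *: eta1 + eta2)) g =
  f * vapp (sharp Pi eta1) g + vapp (sharp Pi eta2) g.
Proof.
apply: smoothfunP => p.
have S z : vapp (sharp Pi z) g p = Pi p (pair2 (dat p g) (z p)) by [].
pose w := pair2 (dat p g) (0 : cotangent p).
have E (v : cotangent p) : pair2 (dat p g) v = [eta w with ord_max |-> v].
  by apply/funext => i; rewrite /w /pair2 /=;
    case: (unliftP ord0 i) => [j ->|->] //; rewrite (ord1 j).
by rewrite sfunD sfunM !S ofunD ofunZ !E mv_linear.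
Qed.

Lemma cder_mv_linearl f eta1 eta2 w :
  cder_mv D (f *: eta1 + eta2) A w = f * cder_mv D eta1 A w +
    cder_mv D eta2 A w.
Proof.
rewrite /cder_mv vapp_sharp_linear.
under eq_bigr => i _ do rewrite cder_linearl pairing_linear.
rewrite big_split -mulr_sumr /=; ring.
Qed.

(** The derivative of [f] appears twice, from the Leibniz rule for the vector field and from that
    for [D] in slot [i], with opposite signs. *)
Lemma cder_mv_linearr eta w i f x y :
  cder_mv D eta A [eta w with i |-> f *: x + y] =
  f * cder_mv D eta A [eta w with i |-> x] +
    cder_mv D eta A [eta w with i |-> y].
Proof.
have E1 : pairing [eta w with i |-> D eta (f *: x + y)] A =
    f * pairing [eta w with i |-> D eta x] A +
    (vapp (sharp Pi eta) f * pairing [eta w with i |-> x] A +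
     pairing [eta w with i |-> D eta y] A).
  by rewrite cderD cder_leibniz -addrA (pairing_linear w i f) pairing_linear.
(* [S] collects the terms in which [D] acts on a slot other than [i]. *)
pose S z := \sum_(l < k | l != i)
  pairing [eta [eta w with l |-> D eta (w l)] with i |-> z] A.
have E2 : S (f *: x + y) = f * S x + S y.
  rewrite mulr_sumr -big_split; apply: eq_bigr => l _; exact: pairing_linear.
have E3 z : cder_mv D eta A [eta w with i |-> z] =
    vapp (sharp Pi eta) (pairing [eta w with i |-> z] A) -
    (pairing [eta w with i |-> D eta z] A + S z).
  rewrite /cder_mv (bigD1 i) //= eqxx upd_upd; congr (_ - (_ + _)).
  by apply: eq_bigr => l li; rewrite (negPf li) upd_comm // eq_sym.
rewrite !E3 E1 E2 pairing_linear vappD vappM; ring.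
Qed.

(** The terms [i] and [j] differ by an exchange of two slots and cancel; every other term still has
    equal entries at [i] and [j]. *)
Lemma cder_mv_alternating eta w i j : i != j -> w i = w j ->
  cder_mv D eta A w = 0.
Proof.
move=> ij wij; rewrite /cder_mv (pairing_alternating ij wij) vapp0 sub0r.
rewrite (bigD1 i) //= (bigD1 j) 1?eq_sym //= big1 => [|l /andP[li lj]];
  last first.
  by apply: (@pairing_alternating _ i j) => //=;
    rewrite ![_ == l]eq_sym (negPf li) (negPf lj).
rewrite addr0; apply/eqP; rewrite oppr_eq0; apply/eqP; apply: smoothfunP => p.
rewrite sfunD !pairing_upd; set v := fun l => w l p.
have := mv_swap (A p) v (D eta (w i) p) (v j) ij.
rewrite (upd_same (i := j)) /= 1?eq_sym ?(negPf ij) // => ->.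
by rewrite [X in [eta X with j |-> _]]upd_same /v ?wij // addNr.
Qed.

End ContravariantAlgebra.

(** * Values at a point of function-linear operations on 1-forms *)

Section PointwiseValue.
Variables (R : realType) (n : nat) (P : manifold R n) (Pi : mvfield P 2).
Variables (D : contravariant_derivative Pi) (k : nat) (A : mvfield P k) (p : P).
Hypothesis vanishing : forall eta : oneform P, eta p = 0 ->
  exists (u : smoothfun P) (G F : 'I_n -> smoothfun P),
    [/\ u p = 0, forall j, G j p = 0 &
        eta = u *: eta + \sum_(j < n) G j *: dform (F j)].
Hypothesis dat_onto : forall w : cotangent p, exists f : smoothfun P, dat p f =
  w.
Implicit Types (eta : oneform P) (w : 'I_k -> oneform P).

Lemma linear_sum (L : oneform P -> smoothfun P) m
    (g : 'I_m -> smoothfun P) (z : 'I_m -> oneform P) :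
  (forall f x y, L (f *: x + y) = f * L x + L y) ->
  L (\sum_(i < m) g i *: z i) = \sum_(i < m) g i * L (z i).
Proof.
move=> linL; elim: (index_enum _) => [|i r IH].
  by have := linL (-1) 0 0; rewrite !big_nil scaler0 addr0 mulN1r addNr.
by rewrite !big_cons linL IH.
Qed.

Lemma linear_at_vanishing (L : oneform P -> smoothfun P) eta :
  (forall f x y, L (f *: x + y) = f * L x + L y) -> eta p = 0 -> L eta p = 0.
Proof.
move=> linL /vanishing[u [G [F [u0 G0 ->]]]].
rewrite linL linear_sum // sfunD sfunM u0 mul0r add0r sfun_sum big1 // => j _.
by rewrite sfunM G0 mul0r.
Qed.

Lemma linear_at_eq (L : oneform P -> smoothfun P) eta1 eta2 :
  (forall f x y, L (f *: x + y) = f * L x + L y) -> eta1 p = eta2 p ->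
  L eta1 p = L eta2 p.
Proof.
move=> linL E; have -> : eta1 = 1 *: (eta1 - eta2) + eta2.
  by rewrite scale1r subrK.
rewrite linL sfunD sfunM (linear_at_vanishing linL) ?mulr0 ?add0r //.
rewrite -[- eta2]scaleN1r addrC -[_ + eta1]/(_ *: eta2 + eta1) ofunD ofunZ.
by rewrite E sfunN scaleN1r addNr.
Qed.

Lemma cder_mv_at_eql eta1 eta2 w : eta1 p = eta2 p ->
  cder_mv D eta1 A w p = cder_mv D eta2 A w p.
Proof.
apply: (@linear_at_eq (fun z => cder_mv D z A w)) => f x y.
exact: cder_mv_linearl.
Qed.

Lemma cder_mv_at_eqr eta w1 w2 : (forall i, w1 i p = w2 i p) ->
  cder_mv D eta A w1 p = cder_mv D eta A w2 p.
Proof.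
(* The arguments are replaced one at a time: [w m] has its first [m] entries from [w2] and the
   others from [w1]. *)
move=> E; pose w m (i : 'I_k) := if (i < m)%N then w2 i else w1 i.
have step m : (m <= k)%N -> cder_mv D eta A (w 0%N) p = cder_mv D eta A (w m) p.
  elim: m => // m IH mk; rewrite IH ?(ltnW mk) //; pose i := Ordinal mk.
  have -> : w m.+1 = [eta w m with i |-> w2 i].
    apply/funext => j /=; rewrite /w ltnS leq_eqVlt -val_eqE /=.
    by case: eqP => // jm; congr w2; apply: val_inj.
  rewrite -[in LHS](@upd_same _ _ (w m) i (w1 i)); last by rewrite /w ltnn.
  apply: (@linear_at_eq (fun z => cder_mv D eta A [eta w m with i |-> z])).
    by move=> f x y; exact: cder_mv_linearr.
  exact: E.
have := step k (leqnn k); congr (_ = _); congr (sfun (cder_mv _ _ _ _) p).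
by apply/funext => i; rewrite /w ltn_ord.
Qed.

(** The defining condition of [cder_at] is satisfied by an actual multivector, so the default of
    [xget] is never reached. *)
Lemma cder_atE (theta : cotangent p) eta w : eta p = theta ->
  cder_at D theta A (fun i => w i p) = cder_mv D eta A w p.
Proof.
move=> etap.
(* [ext] need not be linear; [B0] is linear all the same, because [cder_mv] sees only the values at
   [p]. *)
have [ext extE] : exists ext : cotangent p -> oneform P, forall v, ext v p = v.
  have /choice[h hE] := dat_onto; exists (fun v => dform (h v)) => v; exact: hE.
pose B0 (v : 'I_k -> cotangent p) := cder_mv D eta A (fun i => ext (v i)) p.
have B0_linear v i a x y : B0 [eta v with i |-> a *: x + y] =
    a * B0 [eta v with i |-> x] + B0 [eta v with i |-> y].
  have E z : (fun j => ext ([eta v with i |-> z] j)) =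
      [eta (fun j => ext (v j)) with i |-> ext z].
    by apply/funext => j /=; case: ifP.
  rewrite /B0 !E.
  have := cder_mv_linearr D A eta (fun j => ext (v j)) i
    (scst P a) (ext x) (ext y).
  move=> /(congr1 (fun f : smoothfun P => f p));
    rewrite [in X in _ = X -> _]sfunD.
  rewrite [in X in _ = X + _ -> _]sfunM => <-.
  apply: cder_mv_at_eqr => j /=; case: eqP => // _.
  by rewrite ofunD ofunZ !extE.
have B0_alt v i j : i != j -> v i = v j -> B0 v = 0.
  by move=> ij vij; rewrite /B0 (cder_mv_alternating _ _ _ ij) // vij.
pose B := Multivector B0_linear B0_alt.
rewrite /cder_at; case: xgetP => [B' _|]; first by apply.
move=> /(_ B); case => eta' eta'p w' /=.
rewrite /B0 (@cder_mv_at_eql eta eta') ?etap //.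
by apply: cder_mv_at_eqr => i; rewrite extE.
Qed.

End PointwiseValue.

(** * Sums over shuffles *)

Section Shuffles.

(** Both conditions in [shuffle] have this form, for the restrictions of the permutation to its two
    blocks. *)
Definition incr m n (f : 'I_m -> 'I_n) : bool :=
  [forall i : 'I_m, forall j : 'I_m, (i < j)%N ==> (f i < f j)%N].

Lemma incrP m n (f : 'I_m -> 'I_n) :
  reflect (forall i j : 'I_m, (i < j)%N -> (f i < f j)%N) (incr f).
Proof. by apply: (iffP 'forall_forallP) => H i j; apply/implyP; exact: H. Qed.

Lemma incr_ord1 n (f : 'I_1 -> 'I_n) : incr f.
Proof. by apply/incrP => i j; rewrite (ord1 i) (ord1 j) ltnn. Qed.

Lemma incr_comp_lift m n (j : 'I_n) (f : 'I_m -> 'I_n.-1) :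
  incr (fun i => lift j (f i)) = incr f.
Proof.
apply/incrP/incrP => H i k ik; have := H i k ik; rewrite /= /bump;
  case: (leqP j (f i)) => ?; case: (leqP j (f k)) => ? /=; lia.
Qed.

Lemma incr_perm_ge n (s : 'S_n) : incr s -> forall i : 'I_n, (i <= s i)%N.
Proof.
move=> /incrP si [i]; elim: i => // i IH lti /=.
have := si (Ordinal (ltnW lti)) (Ordinal lti) (ltnSn i).
exact: leq_ltn_trans (IH _).
Qed.

(** The inverse is increasing too, and [incr_perm_ge] applies to both. *)
Lemma incr_perm_eq1 n (s : 'S_n) : incr s -> s = 1%g.
Proof.
move=> si; apply/permP => i; rewrite perm1; apply/val_inj/eqP.
rewrite eqn_leq incr_perm_ge // andbT.
have sVi : incr (s^-1)%g.
  apply/incrP => k l kl; rewrite ltnNge leq_eqVlt negb_or; apply/andP; split.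
    by rewrite -[_ == _]/(s^-1 l == s^-1 k)%g (inj_eq perm_inj) neq_ltn kl orbT.
  apply/negP => /(incrP _ si); rewrite !permKV => lk.
  by have := ltn_trans kl lk; rewrite ltnn.
by have := incr_perm_ge sVi (s i); rewrite permK.
Qed.

(** The map is injective between sets of equal size, since (n+1)! = (n+1) n!. *)
Lemma lift_perm_bij n (i0 : 'I_n.+1) :
  bijective (fun js : 'I_n.+1 * 'S_n => lift_perm i0 js.1 js.2).
Proof.
apply: inj_card_bij => [[j s] [j' s'] /permP E|]; last first.
  by rewrite card_prod !card_Sn card_ord factS.
have := E i0; rewrite !lift_perm_id /= => jj'.
congr pair => //; apply/permP => k; have := E (lift i0 k).
by rewrite !lift_perm_lift /= jj'; exact: lift_inj.
Qed.

Lemma sum_lift_perm (V : nmodType) n (i0 : 'I_n.+1) (Q : pred 'S_n.+1)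
    (G : 'S_n.+1 -> V) :
  \sum_(s | Q s) G s =
  \sum_j \sum_(s : 'S_n | Q (lift_perm i0 j s)) G (lift_perm i0 j s).
Proof.
rewrite (reindex _ (onW_bij _ (lift_perm_bij i0))).
by rewrite (pair_big_dep xpredT (fun j s => Q (lift_perm i0 j s))).
Qed.

(** A permutation increasing away from [i0] is determined by the image of [i0]. *)
Lemma sum_incr_lift (V : nmodType) n (i0 : 'I_n.+1) (G : 'S_n.+1 -> V) :
  \sum_(s : 'S_n.+1 | incr (fun i => s (lift i0 i))) G s =
    \sum_j G (lift_perm i0 j 1).
Proof.
rewrite (sum_lift_perm i0); apply: eq_bigr => j _.
rewrite (big_pred1 (1%g : 'S_n)) // => s /=.
have -> : incr (fun i => lift_perm i0 j s (lift i0 i)) = incr s.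
  rewrite -(incr_comp_lift j s); congr incr; apply/funext => i.
  by rewrite lift_perm_lift.
apply/idP/eqP => [/incr_perm_eq1 //|->].
by apply/incrP => k l; rewrite !perm1.
Qed.

Lemma sum_shuffle1n (V : nmodType) n (G : 'S_(1 + n) -> V) :
  \sum_(s | shuffle s) G s = \sum_(j : 'I_n.+1) G (lift_perm ord0 j 1).
Proof.
rewrite -(sum_incr_lift ord0); apply: eq_bigl => s.
rewrite -[shuffle s]/(incr _ && incr _) incr_ord1 /=; congr incr.
by apply/funext => i; congr (s _); apply: val_inj.
Qed.

(* ['I_(n + 1)] and ['I_n.+1] are not convertible, hence the abstract [N]. *)
Lemma sum_shuffle_last (R : comNzRingType) N n (eN : n.+1 = N)
    (l : 'I_n -> 'I_N) (r : 'I_1 -> 'I_N)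
    (G : ('I_n -> 'I_N) -> 'I_N -> R) :
  (forall i, l i = i :> nat) -> (forall i, r i = n :> nat) ->
  \sum_(s : 'S_N | incr (s \o l) && incr (s \o r))
     (-1) ^+ s * G (s \o l) (s (r ord0)) =
  \sum_(j : 'I_n.+1) (-1) ^+ (n + j) *
     G (fun i => cast_ord eN (lift j i)) (cast_ord eN j).
Proof.
case: N / eN l r G => l r G lE rE.
have lE' i : l i = lift ord_max i by apply: ord_inj; rewrite lE lift_max.
have rE' i : r i = ord_max by apply: ord_inj; rewrite rE.
rewrite (eq_bigl (fun s : 'S_n.+1 => incr (fun i => s (lift ord_max i)))).
  rewrite sum_incr_lift; apply: eq_bigr => j _.
  rewrite rE' lift_perm_id cast_ord_id odd_lift_perm odd_perm1 addbF.
  rewrite -[in RHS]signr_odd oddD; congr (_ * G _ _); apply/funext => i /=.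
  by rewrite lE' lift_perm_lift perm1 cast_ord_id.
move=> s; rewrite incr_ord1 andbT; congr incr.
by apply/funext => i /=; rewrite lE'.
Qed.

(* A shuffle [s] is increasing on the first two indices; together with its
   composite with their exchange it covers all ordered pairs [s 0 <> s 1]. *)
Lemma sum_shuffle2n (V : nmodType) n (G : 'S_(2 + n) -> V) :
  \sum_(s | shuffle s)
     (G s + G (tperm (lshift n ord0) (lshift n ord_max) * s)%g) =
  \sum_(j : 'I_n.+2) \sum_(l : 'I_n.+1)
    G (lift_perm ord0 j (lift_perm ord0 l 1)).
Proof.
pose i0 : 'I_(2 + n) := lshift n ord0; pose i1 : 'I_(2 + n) := lshift n ord_max.
pose Q (s : 'S_(2 + n)) := incr (s \o @rshift 2 n).
have shQ (s : 'S_(2 + n)) : shuffle s = Q s && (s i0 < s i1)%N.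
  rewrite -[shuffle s]/(incr (s \o @lshift 2 n) && Q s) andbC; congr andb.
  apply/incrP/idP => [|s01 i j]; first by apply.
  case: (unliftP ord0 i) => [i'|] ->; case: (unliftP ord0 j) => [j'|] -> //=.
    by rewrite (ord1 i') (ord1 j') ltnn.
  by rewrite (ord1 j') => _; move: s01; congr (s _ < s _)%N; apply: val_inj.
have -> : \sum_(s | shuffle s) (G s + G (tperm i0 i1 * s)%g) =
  \sum_(s | Q s) G s.
  rewrite big_split /= [RHS](bigID (fun s : 'S_(2 + n) => (s i0 < s i1)%N)) /=.
  congr (_ + _); first exact: eq_bigl.
  rewrite [RHS](reindex_inj (mulgI (tperm i0 i1))) /=; apply: eq_bigl => s.
  rewrite shQ !permM tpermL tpermR -leqNgt; congr andb.
    rewrite /Q; congr incr; apply/funext => i /=; rewrite permM tpermD //.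
  by rewrite ltn_neqAle (inj_eq (@ord_inj _)) (inj_eq perm_inj).
(* With the first value [j] fixed, the rest is a permutation increasing away from its own first
   index. *)
rewrite (sum_lift_perm ord0); apply: eq_bigr => j _.
rewrite -(sum_incr_lift ord0 (fun s => G (lift_perm ord0 j s)));
  apply: eq_bigl => s.
rewrite -(incr_comp_lift j (fun i => s (lift ord0 i))); congr incr.
apply/funext => i /=; rewrite -(lift_perm_lift ord0 j s (lift ord0 i));
  congr (lift_perm _ _ _ _).
exact: val_inj.
Qed.

End Shuffles.

(** * The coboundary formula *)

Section WedgeWithVector.
Variables (R : realType) (n : nat) (P : manifold R n) (p : P) (a : nat).
Implicit Types (v : tangent p) (w : 'I_a.+1 -> cotangent p).

(** A (1, a)-shuffle is determined by its first value [j] and has sign (-1)^j: this is the expansion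
    along the vector. *)
Lemma wedge_vec1E v (B : ('I_a -> cotangent p) -> R) w :
  wedge (vec1 v) B w =
  \sum_(j < a.+1) (-1) ^+ j * w j v * B (fun i => w (lift j i)).
Proof.
rewrite /wedge sum_shuffle1n; apply: eq_bigr => j _.
rewrite odd_lift_perm odd_perm1 addbF /= signr_odd; congr (_ * _ * B _).
  rewrite /vec1 (_ : lshift a ord0 = ord0) ?lift_perm_id //; exact: val_inj.
apply/funext => i; rewrite (_ : rshift 1 i = lift ord0 i); last exact: val_inj.
by rewrite lift_perm_lift perm1.
Qed.

Lemma upd_lift_same w i x :
  (fun l => [eta w with i |-> x] (lift i l)) = (fun l => w (lift i l)).
Proof. by apply/funext => l /=; rewrite eq_sym (negPf (neq_lift i l)). Qed.

Lemma upd_lift w j l x :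
  (fun m => [eta w with lift j l |-> x] (lift j m)) =
  [eta (fun m => w (lift j m)) with l |-> x].
Proof. by apply/funext => m /=; rewrite (inj_eq lift_inj). Qed.

Lemma wedge_vec1_linear v (B : multivector p a) w i b x y :
  wedge (vec1 v) B [eta w with i |-> b *: x + y] =
  b * wedge (vec1 v) B [eta w with i |-> x] +
  wedge (vec1 v) B [eta w with i |-> y].
Proof.
rewrite !wedge_vec1E mulr_sumr -big_split; apply: eq_bigr => j _ /=.
have [l ->|->] := unliftP j i; last first.
  by rewrite eqxx !upd_lift_same cfunD cfunZ; ring.
by rewrite !upd_lift mv_linear (negPf (neq_lift j l)); ring.
Qed.

Lemma mv_lift_swap (B : multivector p a) w i k : i != k -> w i = w k ->
  B (fun l => w (lift k l)) =
  (-1) ^+ (i + k).+1 * B (fun l => w (lift i l)).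
Proof.
(* [t] fixes [i], so it induces a permutation [s] of the other indices, which rearranges the list
   omitting [i] into the one omitting [k], up to exchanging the equal entries. *)
move=> ik wik; pose t := (lift_perm i k 1 * tperm i k)%g.
have ti : t i = i by rewrite permM lift_perm_id tpermR.
have [g _ gK] := lift_perm_bij i; have := gK t; case: (g t) => j s /= E.
have ij : j = i by rewrite -ti -E lift_perm_id.
rewrite {}ij in E; have odds : s = ~~ odd (i + k) :> bool.
  have := congr1 (fun s : 'S__ => odd_perm s) E.
  rewrite odd_lift_perm addbb addFb => ->.
  by rewrite odd_permM odd_lift_perm odd_tperm ik odd_perm1 oddD addbF addbT.
rewrite -[LHS]/(mvfun B _) -signr_odd /= -odds -mv_perm; congr (B _).
apply/funext => l /=; rewrite -(lift_perm_lift i) E permM lift_perm_lift perm1.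
by case: tpermP => [->|->|//].
Qed.

(** In the expansion, terms [i] and [k] cancel by [mv_lift_swap]; the others feed equal covectors to
    [B]. *)
Lemma wedge_vec1_alternating v (B : multivector p a) w i k :
  i != k -> w i = w k -> wedge (vec1 v) B w = 0.
Proof.
move=> ik wik; rewrite wedge_vec1E (bigD1 i) //= (bigD1 k) 1?eq_sym //=.
rewrite (mv_lift_swap B ik wik) big1 => [|j /andP[ji jk]]; last first.
  have [i' Ei _] := unlift_some ji; have [k' Ek _] := unlift_some jk.
  rewrite (@mv_alternating _ _ _ _ _ B _ i' k') ?mulr0 -?Ei -?Ek //.
  by apply: contra_neq ik => E; rewrite Ei Ek E.
rewrite addr0 wik exprS exprD; set s := (-1) ^+ i; set u := (-1) ^+ k.
have u2 : u * u = 1 by rewrite -expr2 sqrr_sign.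
set b := B _; set x := w k v.
by rewrite [u * x * _](_ : _ = - (u * u * (s * x * b)));
  [rewrite u2 mul1r subrr | ring].
Qed.

End WedgeWithVector.

(** * Hamiltonian vector fields and the bracket of exact 1-forms *)

Section Coboundary.
Variables (R : realType) (n : nat) (P : manifold R n) (Pi : mvfield P 2).
Local Notation C := (smoothfun P).
Implicit Types (f g : C) (p : P).

Lemma vapp_sharp_dform f g : vapp (sharp Pi (dform f)) g =
  pairing (pair2 (dform g) (dform f)) Pi.
Proof.
apply: smoothfunP => p /=; congr (Pi p _).
by apply/funext => i; rewrite /pair2; case: ifP.
Qed.

Lemma pair2_skew (x y : oneform P) : pairing (pair2 x y) Pi =
  - pairing (pair2 y x) Pi.
Proof.
apply: smoothfunP => p; rewrite sfunN /=.
have := mv_tperm (Pi p) (fun i => pair2 y x i p) (isT :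
  ord0 != ord_max :> 'I_2).
move=> <-; congr (Pi p _); apply/funext => i /=; rewrite /pair2.
by case: (tpermP ord0 ord_max i) => [->|->|] //;
  case: (unliftP ord0 i) => [j|] -> //; rewrite (ord1 j) => _ /eqP.
Qed.

(** Here L_X dk = d(Xk), so the bracket is d(X_f g) - d(X_g f) + d<df /\ dg, Pi>, and X_g f = <df /\
    dg, Pi> cancels the last two terms. *)
Lemma form_bracket_dform f g (Y : vfield P) :
  form_bracket Pi (dform f) (dform g) Y = vapp Y (vapp (sharp Pi (dform f)) g).
Proof.
have lieE (h k : C) : lie_derivative (sharp Pi (dform h)) (dform k) Y =
  vapp Y (vapp (sharp Pi (dform h)) k).
  apply: smoothfunP => p; rewrite /lie_derivative sfunD sfunN /=.
  by rewrite opprB addrC subrK.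
by rewrite /form_bracket !lieE !vapp_sharp_dform subrK.
Qed.

Lemma sfun_signM (k : nat) f p : ((-1) ^+ k * f) p = (-1) ^+ k * f p.
Proof.
by rewrite -signr_odd -[in RHS]signr_odd; case: odd;
  rewrite ?mul1r // !mulN1r sfunN.
Qed.

End Coboundary.

(** * The two halves of the Schouten bracket with [Pi] *)

Section Insertion.
Variables (R : realType) (n : nat) (P : manifold R n) (Pi : mvfield P 2).
Variables (D : contravariant_derivative Pi) (p : P).
Local Notation C := (smoothfun P).
Hypothesis cder_dform : forall f g : C,
  D (dform f) (dform g) p - D (dform g) (dform f) p =
  dat p (vapp (sharp Pi (dform f)) g).

(** Built with [unlift ord0], like the arguments in [insertion], so that the two compare case by
    case. *)
Definition mcons (T : Type) m (x : T) (w : 'I_m -> T) (i : 'I_m.+1) : T :=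
  if unlift ord0 i is Some j then w j else x.

Lemma mcons_upd (T : Type) m (x y : T) (w : 'I_m -> T) :
  mcons x w = [eta mcons y w with ord0 |-> x].
Proof.
apply/funext => i; rewrite /mcons /=.
by case: (unliftP ord0 i) => [j|] ->.
Qed.

Lemma mv_mcons_linear k (B : multivector p k.+1) w b x y :
  B (mcons (b *: x + y) w) = b * B (mcons x w) + B (mcons y w).
Proof.
by rewrite (mcons_upd _ 0) mv_linear -!mcons_upd.
Qed.

Lemma mv_mconsZ k (B : multivector p k.+1) w b x :
  B (mcons (b *: x) w) = b * B (mcons x w).
Proof. by rewrite (mcons_upd _ 0) mvZ -mcons_upd. Qed.

(** Moving slot [l] to the front is a cycle of sign (-1)^l. *)
Lemma mv_upd_mcons k (B : multivector p k.+1) w l x :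
  B [eta w with l |-> x] = (-1) ^+ l * B (mcons x (fun i => w (lift l i))).
Proof.
have -> : mcons x (fun i => w (lift l i)) =
  [eta w with l |-> x] \o lift_perm ord0 l 1.
  apply/funext => i; rewrite /mcons /=; case: unliftP => [j|] ->.
    by rewrite lift_perm_lift perm1 eq_sym (negPf (neq_lift l j)).
  by rewrite lift_perm_id eqxx.
by rewrite mv_perm odd_lift_perm odd_perm1 addbF /= signr_odd mulrA -expr2
  sqrr_sign mul1r.
Qed.

(** Each shuffle accounts for two ordered pairs of indices; vanishing torsion, in the form
    [cder_dform], merges their two terms into one. *)
Lemma insertion_poisson a (A : mvfield P a.+1) (F : 'I_a.+2 -> C) :
  insertion A Pi (fun i => F (cast_ord (congr1 predn (addn2 a.+1)) i)) p =
  - \sum_(j < a.+2) (-1) ^+ j * \sum_(l < a.+1)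
      A p [eta (fun m => dat p (F (lift j m))) with l |->
            D (dform (F j)) (dform (F (lift j l))) p].
Proof.
pose i0 : 'I_(2 + a) := lshift a ord0; pose i1 : 'I_(2 + a) := lshift a ord_max.
pose rest (s : 'S_(2 + a)) (i : 'I_a) := dat p (F (s (rshift 2 i))).
(* The term of the ordered pair (s 0, s 1), with its derivative moved to the first slot. *)
pose G (s : 'S_(2 + a)) := (-1) ^+ s *
  A p (mcons (D (dform (F (s i0))) (dform (F (s i1))) p) (rest s)).
transitivity (- \sum_(j < a.+2) \sum_(l < a.+1)
    G (lift_perm ord0 j (lift_perm ord0 l 1))); last first.
  congr (- _); apply: eq_bigr => j _; rewrite mulr_sumr; apply: eq_bigr => l _.
  rewrite /G /rest (_ : i0 = ord0); last exact: val_inj.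
  rewrite (_ : i1 = lift ord0 ord0); last exact: val_inj.
  rewrite mv_upd_mcons mulrA lift_perm_id lift_perm_lift lift_perm_id.
  rewrite !odd_lift_perm odd_perm1 addbF /= signr_addb !signr_odd;
    congr (_ * A p (mcons _ _)).
  apply/funext => i; rewrite (_ : rshift 2 i = lift ord0 (lift ord0 i));
    last exact: val_inj.
  by rewrite !lift_perm_lift perm1.
rewrite -sum_shuffle2n /= sfun_sum -sumrN; apply: eq_bigr => s _.
rewrite sfun_signM -/i0 -/i1 /G odd_permM odd_tperm.
have -> : i0 != i1 by [].
rewrite signr_addb expr1 mulN1r mulNr !permM tpermL tpermR -mulrBr -mulrN;
  congr (_ * _).
have -> : rest (tperm i0 i1 * s)%g = rest s.
  by apply/funext => i; rewrite /rest permM tpermD.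
set w := rest s.
have F'E (i : 'I_(2 + a)) :
    F (cast_ord (congr1 predn (addn2 a.+1)) (cast_ord (addnC 2 a) i)) = F i.
  by congr F; apply: val_inj.
set x := D (dform (F (s i0))) _ p; set y := D (dform (F (s i1))) _ p.
have -> : A p (mcons x w) - A p (mcons y w) = A p (mcons (x - y) w).
  by rewrite [x - y]addrC -[- y]scaleN1r mv_mcons_linear mulN1r addrC.
rewrite /x /y cder_dform -mulN1r -mv_mconsZ /=; congr (A p _).
apply/funext => i; rewrite /mcons; case: unlift => [j|]; first by rewrite F'E.
(* X_f g is <dg /\ df, Pi>, whereas the bracket has Pi(f, g): this is the source of the leading
   minus sign. *)
rewrite vapp_sharp_dform pair2_skew.
have datN h : dat p (- h) = -1 *: dat p h.
  apply: cotangentP => v; rewrite cfunZ /=.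
  by have := tfun_linear v (-1) h 0; rewrite tfun_zero !addr0 scaleN1r.
rewrite datN scalerA mulrNN mulr1 scale1r; congr dat; apply: smoothfunP => q /=.
congr (Pi q _); apply/funext => m; rewrite F'E /pair2.
by case: (unliftP ord0 m) => [m'|] -> /=; rewrite -/i0 ?(ord1 m');
  congr (dat q (F (s _))); apply: val_inj.
Qed.

(** An (a, 1)-shuffle singles out the index [j] put last, with sign (-1)^(a+j), and Pi(h, F_j) is
    the derivative of h along the sharp of dF_j. *)
Lemma insertion_poissonl a (A : mvfield P a) (F : 'I_a.+1 -> C) :
  insertion Pi A (fun i => F (cast_ord (congr1 predn (addn2 a))
     (cast_ord (congr1 predn (addnC 2 a)) i))) p =
  \sum_(j < a.+1) (-1) ^+ (a + j) *
     vapp (sharp Pi (dform (F j))) (mapp A (fun i => F (lift j i))) p.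
Proof.
rewrite /insertion /= sfun_sum.
have eN : a.+1 = (a + 1)%N by rewrite addn1.
pose H (u : 'I_a -> 'I_(a + 1)) (r : 'I_(a + 1)) :=
  vapp (sharp Pi (dform (F (cast_ord (esym eN) r))))
    (mapp A (fun i => F (cast_ord (esym eN) (u i)))) p.
rewrite (eq_bigr (fun s : 'S_(a + 1) =>
    (-1) ^+ s * H (s \o @lshift a 1) (s (rshift a ord0)))).
  rewrite (eq_bigl (fun s : 'S_(a + 1) =>
    incr (s \o @lshift a 1) && incr (s \o @rshift a 1))) //.
  rewrite (@sum_shuffle_last _ _ _ eN) //.
  2: by move=> i; rewrite (ord1 i) /= addn0.
  apply: eq_bigr => j _; rewrite /H cast_ordK; congr (_ * vapp _ (mapp A _) p).
  by apply/funext => i; rewrite cast_ordK.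
move=> s _; rewrite sfun_signM /H vapp_sharp_dform; congr (_ * _).
have FE (i : 'I_(a + 1)) : F (cast_ord (congr1 predn (addn2 a))
    (cast_ord (congr1 predn (addnC 2 a)) (cast_ord (addnC a 1%N) i))) =
    F (cast_ord (esym eN) i).
  by congr F; apply: val_inj.
congr (Pi p _); apply/funext => m; rewrite /pair2 /=.
case: (unliftP ord0 m) => [m'|] -> /=.
  by rewrite FE (ord1 m').
congr (dat p (mapp A _)); apply/funext => i; exact: FE.
Qed.

End Insertion.

(** * The coboundary through the contravariant derivative *)

Section CoboundaryFormula.
Variables (R : realType) (n : nat) (P : manifold R n) (Pi : mvfield P 2).
Variables (D : contravariant_derivative Pi).
Hypothesis hT : torsion_free D.
Variables (c : chart R n P) (hc : atlas c).
Variables (e : 'I_n -> forall p : P, tangent p).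
Hypothesis he : local_frame (cdom c) e.
Local Notation C := (smoothfun P).

Lemma frame_at p : cdom c p ->
  forall v : tangent p, exists! x : 'rV[R]_n, v = \sum_(i < n) x 0 i *: e i p.
Proof. exact: he.2. Qed.

(** Torsion is tested on global vector fields, hence on the cut-off frame; the factor [chi p] is
    then cancelled. *)
Lemma torsion_free_dform (f g : C) p : cdom c p ->
  D (dform f) (dform g) p - D (dform g) (dform f) p =
  dat p (vapp (sharp Pi (dform f)) g).
Proof.
move=> cp; have [chi [E [chip _ EE]]] := frame_vfields hc he cp.
apply: (cotangent_frame_eq (frame_at cp)) => i.
apply: (mulfI chip); rewrite -!cfun_scale -EE.
have := hT (dform f) (dform g) (E i); rewrite /torsion form_bracket_dform.
move=> /eqP; rewrite subr_eq0 => /eqP/(congr1 (fun h : C => h p)).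
rewrite [in X in X -> _]sfunD sfunN => T.
rewrite -[- D _ _ p]scaleN1r cfunD cfunZ mulN1r; exact: T.
Qed.

Lemma coboundary_funE a (A : mvfield P a) (F : 'I_a.+1 -> C) p : cdom c p ->
  coboundary_fun Pi A F p =
  - \sum_(j < a.+1) (-1) ^+ j *
      cder_mv D (dform (F j)) A (fun i => dform (F (lift j i))) p.
Proof.
move=> cp; have hD f g := torsion_free_dform f g cp.
rewrite /coboundary_fun /schouten sfunN sfunD sfunN sfun_signM
  insertion_poissonl.
have -> : insertion A Pi (fun i => F (cast_ord (congr1 predn (addn2 a)) i)) p =
  - \sum_(j < a.+1) (-1) ^+ j * \sum_(l < a)
      A p [eta (fun m => dat p (F (lift j m))) with l |->
            D (dform (F j)) (dform (F (lift j l))) p].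
  (* For [a = 0] the insertion is 0 by definition and the inner sums are empty. *)
  case: a A F => [|a] A F; last exact: insertion_poisson.
  by rewrite [in RHS]big1 ?oppr0 // => j _; rewrite big_ord0 mulr0.
congr (- _); rewrite mulr_sumr -opprD -big_split -sumrN.
apply: eq_bigr => j _; cbv beta; rewrite /cder_mv sfunD sfunN sfun_sum.
under [in RHS]eq_bigr => l _ do rewrite pairing_upd.
(* The total exponent 4a + 3 + j has the parity of j + 1. *)
have -> : (-1) ^+ (a.+1 * 3) * ((-1) ^+ (a + j) *
    vapp (sharp Pi (dform (F j))) (mapp A (fun i => F (lift j i))) p) =
  - ((-1) ^+ j *
     vapp (sharp Pi (dform (F j))) (mapp A (fun i => F (lift j i))) p).
  rewrite mulrA -mulNr; congr (_ * _); rewrite -exprD -[RHS]mulN1r -exprS.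
  rewrite -[LHS]signr_odd -[RHS]signr_odd; congr (_ ^+ nat_of_bool _); lia.
by rewrite opprD opprK addrC mulrBr.
Qed.

(** At [p] the form [eta] is the sum of the eta(e_i) theta^i, and only values at [p] matter;
    constant coefficients therefore suffice. *)
Lemma cder_mv_frame (theta : 'I_n -> forall p : P, cotangent p)
    a (A : mvfield P a)
    (eta : oneform P) (h : 'I_n -> oneform P) (w : 'I_a -> oneform P) p :
  dual_coframe (cdom c) e theta -> cdom c p ->
  (forall i, h i p = theta i p) ->
  cder_mv D eta A w p = \sum_i eta p (e i p) * cder_mv D (h i) A w p.
Proof.
move=> hth cp hE; have van z := @vanishing_oneform _ _ _ c e hc he p z cp.
pose g i := scst P (eta p (e i p)).
rewrite (@cder_mv_at_eql _ _ _ _ _ _ _ _ van eta (\sum_i g i *: h i)).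
  rewrite (@linear_sum _ _ _ (fun z => cder_mv D z A w)); last first.
    by move=> f x y; exact: cder_mv_linearl.
  by rewrite sfun_sum.
apply: (cotangent_frame_eq (frame_at cp)) => k.
rewrite ofun_sum.
have sumE (r : seq 'I_n) : uniq r -> (\sum_(i <- r) g i p *: h i p) (e k p) =
  if k \in r then eta p (e k p) else 0.
  elim: r => [|i r IH] /=; first by rewrite big_nil.
  case/andP => ir ur; rewrite big_cons cfunD cfunZ IH // hE hth // inE eq_sym.
  case: eqP ir => [->|_] ir; last by rewrite mulr0 add0r.
  by rewrite (negPf ir) mulr1 addr0.
by rewrite sumE ?index_enum_uniq // mem_index_enum.
Qed.

End CoboundaryFormula.

Theorem theorem4p3 (R : realType) (n : nat) (P : manifold R n)
    (Pi : mvfield P 2) (hPi : poisson Pi)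
    (D : contravariant_derivative Pi)
    (hD : poisson_connection D) (hT : torsion_free D)
    (c : chart R n P) (hc : atlas c)
    (e : 'I_n -> forall p : P, tangent p) (he : local_frame (cdom c) e)
    (theta : 'I_n -> forall p : P, cotangent p)
    (htheta : dual_coframe (cdom c) e theta)
    (a : nat) (A : mvfield P a) :
  forall p : P, cdom c p ->
    mvfun (coboundary Pi A p) =
    - \sum_(i < n) wedge (vec1 (e i p)) (cder_at D (theta i p) A).
Proof.
move=> p cp; have van z := vanishing_oneform hc he cp (eta := z).
have onto : forall w : cotangent p, exists f, dat p f = w :=
  covector_dat (frame_at he cp).
pose W v := - \sum_(i < n) wedge (vec1 (e i p)) (cder_at D (theta i p) A) v.
have WF (F : 'I_a.+1 -> smoothfun P) :
    W (fun i => dat p (F i)) = coboundary_fun Pi A F p.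
  have [h hE] := choice (fun i => onto (theta i p)).
  have hE' i : dform (h i) p = theta i p by exact: hE.
  rewrite (coboundary_funE hT hc he) // /W; congr (- _).
  under eq_bigr => i _ do rewrite wedge_vec1E.
  (* For fixed [j], the sum over [i] of e_i(F_j) D_{theta^i} A reassembles D_{dF_j} A. *)
  rewrite exchange_big; apply: eq_bigr => j _; cbv beta.
  rewrite (cder_mv_frame D hc he A (dform (F j)) _ htheta cp hE').
  rewrite mulr_sumr; apply: eq_bigr => i _; rewrite -mulrA; congr (_ * (_ * _)).
  apply: (@cder_atE _ _ _ _ _ _ _ _ van onto (theta i p) (dform (h i))
    (fun m => dform (F (lift j m)))); exact: hE.
have W_linear v i b x y : W [eta v with i |-> b *: x + y] =
  b * W [eta v with i |-> x] + W [eta v with i |-> y].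
  rewrite /W mulrN -opprD mulr_sumr -big_split; congr (- _).
  by apply: eq_bigr => j _; exact: wedge_vec1_linear.
have W_alt v i j : i != j -> v i = v j -> W v = 0.
  move=> ij vij; rewrite /W big1 ?oppr0 // => k _.
  exact: wedge_vec1_alternating ij vij.
have -> : - \sum_(i < n) wedge (vec1 (e i p)) (cder_at D (theta i p) A) = W.
  by apply/funext => v; rewrite /W fctE fct_sumE.
(* A chosen [B] agrees with [W] on differentials, which exhaust the covectors; and [W], being a
   multivector, excludes the default case. *)
rewrite /coboundary; case: xgetP => [B _ BF|noB].
  apply/funext => v; have [F FE] := choice (fun i => onto (v i)).
  have -> : v = fun i => dat p (F i) by apply/funext => i; rewrite FE.
  by rewrite BF WF.
by case: (noB (Multivector W_linear W_alt)) => F; exact: WF.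
Qed.
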